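(* Let $0<p<t<1$ and suppose $(p,t)$ belongs to the replica symmetric phase. Then there exists some $\alpha\in[2/3,1]$ for which the triangle tilt $\mathbb{Q}_n^{h_p,\beta,\alpha}$ with parameters $(h_p,\beta,\alpha)$, where $$\beta=\frac{h_t-h_p}{\alpha t^{3\alpha-1}},\qquad h_p=\log\frac{p}{1-p},\quad h_t=\log\frac{t}{1-t},$$ produces an asymptotically optimal importance sampling scheme (for the event $\mathcal{W}_t$ under $\mathbb{P}_{n,p}$).
   Context: **Graphons.** $\mathcal{W}$ is the set of measurable symmetric functions $f:[0,1]^2\to[0,1]$, modulo identifying $f$ and $g$ when $f(x,y)=g(\sigma x,\sigma y)$ for a measure-preserving bijection $\sigma$ of $[0,1]$ (functions equal a.e. are identified). For $f\in\mathcal{W}$: $\mathcal{E}(f)=\int\int f(x,y)\,dx\,dy$, $\mathcal{T}(f)=\int\int\int f(x,y)f(y,z)f(x,z)\,dx\,dy\,dz$ (integrals over $[0,1]$), and $\mathcal{W}_t=\{f\in\mathcal{W}:\mathcal{T}(f)\ge t^3\}$. **Rate function.** $I_p(u)=\frac12\left(u\log\frac up+(1-u)\log\frac{1-u}{1-p}\right)$ for $u\in[0,1]$ (with $0\log 0=0$), and $\mathcal{I}_p(f)=\int_0^1\int_0^1I_p(f(x,y))\,dx\,dy$. **Replica symmetric phase.** $(p,t)$ belongs to the replica symmetric phase if $\inf_{f\in\mathcal{W}_t}\mathcal{I}_p(f)=I_p(t)$ and the infimum is uniquely attained at the constant function $t$. **Graphs.** $\Omega_n=\{0,1\}^{\binom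 n2}$ is the set of simple graphs $X$ on $n$ vertices. $X$ is identified with the graphon equal to $X_{ij}$ on $[\frac{i-1}n,\frac in)\times[\frac{j-1}n,\frac jn)$ ($X_{ji}=X_{ij}$, $X_{ii}=0$), so $\mathcal{E}(X)=\frac2{n^2}\#\{\text{edges}\}$ and $\mathcal{T}(X)=\frac6{n^3}\#\{\text{triangles}\}$. $\mathbb{P}_{n,p}$ is the law of the Erdős–Rényi graph $\mathcal{G}_{n,p}$ (independent edges with probability $p$). **Triangle tilt.** $\mathbb{Q}_n^{h_p,\beta,\alpha}$ is the probability measure on $\Omega_n$ with $\mathbb{Q}_n^{h_p,\beta,\alpha}(X)\propto\exp\left(n^2\left(\frac{h_p}2\mathcal{E}(X)+\frac\beta6\mathcal{T}(X)^\alpha\right)\right)$. **Asymptotic optimality.** Importance sampling based on $\mathbb{Q}_n$ estimates $\mathbb{P}_{n,p}(\mathcal{W}_t)$ by averaging $\mathbf{1}_{\mathcal{W}_t}(\tilde X)\frac{d\mathbb{P}_{n,p}}{d\mathbb{Q}_n}(\tilde X)$ over i.i.d. samples $\tilde X\sim\mathbb{Q}_n$. The scheme based on $\mathbb{Q}_n$ is (asymptotically) optimal if $$\lim_{n\to\infty}\frac1{n^2}\log\mathbb{E}_{\mathbb{Q}_n}\left[\left(\mathbf{1}_{\mathcal{W}_t}\frac{d\mathbb{P}_{n,p}}{d\mathbb{Q}_n}\right)^2\right]=-2\inf_{f\in\mathcal{W}_t}\mathcal{I}_p(f).$$ *)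

(* Defs.v *)
From HB Require Import structures.
From mathcomp Require Import all_boot all_order all_algebra.
From mathcomp Require Import all_classical all_reals all_analysis.

Set Implicit Arguments.
Unset Strict Implicit.
Unset Printing Implicit Defensive.

Import Order.TTheory GRing.Theory Num.Theory.
Import numFieldNormedType.Exports.

Local Open Scope classical_set_scope.
Local Open Scope ring_scope.

Section Graphons.
Context {R : realType}.

Notation mu := (@lebesgue_measure R).
Notation I01 := (`[0%R, 1%R]%classic : set R).

(* A graphon is a representative f : R -> R -> R, of which only the values on
   the unit square matter; measurable means Borel, and every class of Lebesgue
   measurable functions modulo a.e. equality has a Borel representative. *)
Definition graphon : set (R -> R -> R) := [set f : R -> R -> R |
  [/\ measurable_fun (I01 `*` I01) (fun z : R * R => f z.1 z.2),
      {in I01 &, forall x y, f x y = f y x} &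
      {in I01 &, forall x y, 0 <= f x y <= 1}]].

Definition mp_bijection01 (sigma : R -> R) : Prop :=
  [/\ set_bij I01 I01 sigma,
      measurable_fun I01 sigma &
      forall A : set R, measurable A -> A `<=` I01 ->
        mu (I01 `&` sigma @^-1` A) = mu A].

(* The identification made in the space of graphons. All the functionals below
   are constant on its classes, so no quotient type is formed. *)
Definition graphon_equiv (f g : R -> R -> R) : Prop :=
  exists sigma, mp_bijection01 sigma /\
    {ae (mu \x mu)%E, forall z : R * R, (I01 `*` I01) z ->
      f z.1 z.2 = g (sigma z.1) (sigma z.2)}.

Definition edge_density (f : R -> R -> R) : R :=
  \int[mu]_(x in I01) \int[mu]_(y in I01) f x y.

Definition triangle_density (f : R -> R -> R) : R :=
  \int[mu]_(x in I01) \int[mu]_(y in I01) \int[mu]_(z in I01)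
    (f x y * f y z * f x z).

Definition upper_tail (t : R) : set (R -> R -> R) :=
  [set f | graphon f /\ t ^+ 3 <= triangle_density f].

(* The convention 0 log 0 = 0 is automatic, since [0 * _ = 0]. *)
Definition rate (p u : R) : R :=
  2^-1 * (u * ln (u / p) + (1 - u) * ln ((1 - u) / (1 - p))).

Definition graphon_rate (p : R) (f : R -> R -> R) : R :=
  \int[mu]_(x in I01) \int[mu]_(y in I01) rate p (f x y).

Definition inf_rate (p t : R) : R := inf (graphon_rate p @` upper_tail t).

Definition replica_symmetric (p t : R) : Prop :=
  inf_rate p t = rate p t /\
  forall f, upper_tail t f ->
    (graphon_rate p f = inf_rate p t <-> graphon_equiv f (fun _ _ => t)).

End Graphons.

Section RandomGraphs.
Context {R : realType}.

Definition potential_edge (n : nat) := {e : {set 'I_n} | #|e| == 2}.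

Definition sgraph (n : nat) := {ffun potential_edge n -> bool}.

(* Since [set i; i] has one element, [adj X i i = false]. *)
Definition adj n (X : sgraph n) (i j : 'I_n) : bool :=
  [exists e : potential_edge n, (val e == [set i; j]%SET) && X e].

(* The value is [adj X i j] on [i/n, (i+1)/n) x [j/n, (j+1)/n), as 'I_n is
   numbered from 0, and 0 on the null set where x = 1 or y = 1. *)
Definition graph_graphon n (X : sgraph n) : R -> R -> R := fun x y =>
  \sum_(i < n) \sum_(j < n)
    (adj X i j)%:R * \1_`[i%:R / n%:R, i.+1%:R / n%:R[ x
                   * \1_`[j%:R / n%:R, j.+1%:R / n%:R[ y.

(* Probability measures on the finite set of graphs are given by their mass
   functions. *)
Definition erdos_renyi (n : nat) (p : R) (X : sgraph n) : R :=
  \prod_(e : potential_edge n) (if X e then p else 1 - p).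

(* As [0 `^ alpha = 0] for [alpha != 0], triangle-free graphs cause no
   difficulty. *)
Definition tilt_weight (n : nat) (h beta alpha : R) (X : sgraph n) : R :=
  expR (n%:R ^+ 2 * (h / 2 * edge_density (graph_graphon X) +
    beta / 6 * (triangle_density (graph_graphon X)) `^ alpha)).

Definition triangle_tilt (n : nat) (h beta alpha : R) (X : sgraph n) : R :=
  tilt_weight h beta alpha X / \sum_(Y : sgraph n) tilt_weight h beta alpha Y.

Definition expectation_pmf n (Q : sgraph n -> R) (g : sgraph n -> R) : R :=
  \sum_(X : sgraph n) Q X * g X.

Definition second_moment (p t : R) n (Q : sgraph n -> R) : R :=
  expectation_pmf Q (fun X =>
    (\1_(upper_tail t) (graph_graphon X) * (erdos_renyi p X / Q X)) ^+ 2).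

Definition asymptotically_optimal (p t : R) (Q : forall n, sgraph n -> R) :
    Prop :=
  (fun n : nat => (n%:R ^+ 2)^-1 * ln (second_moment p t (Q n))) @ \oo -->
    - 2 * inf_rate p t.

Definition logit (u : R) : R := ln (u / (1 - u)).

End RandomGraphs.

(* Main.v *)
Require Import Defs.
From HB Require Import structures.
From mathcomp Require Import all_boot all_order all_algebra.
From mathcomp Require Import all_classical all_reals all_analysis.
From mathcomp Require Import measurable_realfun ring lra.

Set Implicit Arguments.
Unset Strict Implicit.
Unset Printing Implicit Defensive.

Import Order.TTheory GRing.Theory Num.Theory.
Import numFieldNormedType.Exports.

Local Open Scope classical_set_scope.
Local Open Scope ring_scope.

(** The exponent [2 / 3] works throughout the replica symmetric phase. For it,
    with [c = (h_t - h_p) / (4 * t)], one gets [beta = 6 * c], and the tilted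
    law has density proportional to [exp (n^2 * c * T^(2/3))] with respect to
    the Erdos-Renyi law. Write [I] for the rate function [rate p], and [Z] for
    the expectation of that density factor under the Erdos-Renyi law.

    Convexity. If [I u < I t + c * (u^2 - t^2)] for some [u], one could mix a
    little of the value [u] into the constant graphon [t], in the shape of a
    two-block graphon, adjust the rest to keep the triangle density at least
    [t^3], and thereby lower the rate. Hence, on the unit interval,
    [I u >= I t + c * (u^2 - t^2)]: this parabola supports [I] at [t], or, in
    other words, the point [(t^2, I t)] is on the convex minorant of [x |-> I (sqrt x)]
    ([replica_symmetric_quadratic_minorant]).

    Upper bound. On the rare event [T >= t^3], the likelihood ratio is at most
    [Z * exp (- n^2 * c * t^2)], and the indicator of the event is at most
    [exp (n^2 * c * (T^(2/3) - t^2))], so that the second moment is at most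
    [(Z * exp (- n^2 * c * t^2))^2] ([second_moment_le]). It remains to show
    [Z <= exp (n^2 * (c * t^2 - I t) + o(n^2))]. The inequality
    [T(W)^(2/3) <= |W|_2^2], from Cauchy-Schwarz, is too weak for a graph, as
    an adjacency matrix [A] has far too large a Hilbert-Schmidt norm. One first
    replaces [A] by a kernel [W], close to it in cut norm, from a list of
    [exp (O(n))] kernels, for which moreover [|W|^2 <= <A, W> + o(n^2)]. Then
    [n^2 * T^(2/3)] is at most [2 * <A, W> - |W|^2 + o(n^2)], which is affine
    in the independent edges. A union bound over the list leaves a product of
    Bernoulli moment generating functions; by Legendre duality the parabola
    bounds each of them by a Gaussian one, and the resulting quadratic term is
    cancelled exactly by [- c * |W|^2] ([exponential_moment_le]).

    Lower bound. By Cauchy-Schwarz the second moment is at least the square of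
    the Erdos-Renyi probability of the event ([sqr_tail_probability_le]). For
    [s] slightly above [t], the mean triangle density with edge probability [s]
    exceeds [t^3] by a constant, so that the event has a probability bounded
    below; by Chernoff the number of edges is not much larger than its mean,
    and the change of measure from [s] back to [p] costs
    [exp (- n^2 * I s - o(n^2))] ([tail_probability_ge]). *)

(** * Triangle sums of finite kernels and weak regularity *)

Section FiniteKernels.
Context {R : realType} {I : finType}.
Implicit Types A W : I -> I -> R.

Definition kernel_dot A W : R := \sum_i \sum_j A i j * W i j.

Definition kernel_triangle W : R :=
  \sum_i \sum_j \sum_k W i j * W j k * W i k.

Lemma sum_cauchy_schwarz (J : finType) (a b : J -> R) :
  (\sum_j a j * b j) ^+ 2 <= (\sum_j a j ^+ 2) * (\sum_j b j ^+ 2).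
Proof.
set s := \sum_j a j * b j; set x := \sum_j a j ^+ 2; set y := \sum_j b j ^+ 2.
have x0 : 0 <= x by apply: sumr_ge0 => j _; exact: sqr_ge0.
have : 0 <= \sum_j (x * b j - s * a j) ^+ 2 by apply: sumr_ge0 => j _; exact: sqr_ge0.
have -> : \sum_j (x * b j - s * a j) ^+ 2 = x * (x * y - s ^+ 2).
  have expand u v : \sum_j (u * b j - v * a j) ^+ 2 =
      u ^+ 2 * y - 2 * u * v * s + v ^+ 2 * x.
    rewrite /x /y /s !mulr_sumr -sumrB -big_split /=.
    by apply: eq_bigr => j _; ring.
  by rewrite expand; ring.
(* For [x > 0] divide by [x]; for [x = 0] all the [a j] vanish. *)
have [x_gt0|] := ltP 0 x; first by rewrite pmulr_rge0// subr_ge0.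
move=> xle0 _; have x00 : x = 0 by apply/eqP; rewrite eq_le xle0.
rewrite x00 mul0r /s big1 ?expr0n// => j _.
have := psumr_eq0P (fun j _ => sqr_ge0 (a j)) x00 => /(_ j isT)/eqP.
by rewrite sqrf_eq0 => /eqP ->; rewrite mul0r.
Qed.

(** The finite form of [T(W) <= |W|_2^3]: Cauchy-Schwarz is applied to the pair
    [(i, j)] first, and then to the common neighbour [k]. *)
Lemma kernel_triangle_cauchy_schwarz W :
  kernel_triangle W ^+ 2 <= kernel_dot W W ^+ 3.
Proof.
pose q (z : I * I) := \sum_k W z.2 k * W z.1 k.
have -> : kernel_triangle W = \sum_z W z.1 z.2 * q z.
  rewrite /kernel_triangle pair_bigA /=; apply: eq_bigr => -[i j] _ /=.
  by rewrite mulr_sumr; apply: eq_bigr => k _; ring.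
have dotE : kernel_dot W W = \sum_(z : I * I) W z.1 z.2 ^+ 2.
  by rewrite /kernel_dot pair_bigA /=; apply: eq_bigr => z _; rewrite expr2.
have dot0 : 0 <= kernel_dot W W.
  by rewrite dotE; apply: sumr_ge0 => z _; exact: sqr_ge0.
apply: le_trans (sum_cauchy_schwarz _ _) _.
rewrite -dotE exprS ler_wpM2l//.
have -> : kernel_dot W W ^+ 2 =
    \sum_(z : I * I) (\sum_k W z.2 k ^+ 2) * (\sum_k W z.1 k ^+ 2).
  rewrite -(pair_bigA _ (fun i j => (\sum_k W j k ^+ 2) * (\sum_k W i k ^+ 2))) /=.
  rewrite exchange_big /= expr2 /kernel_dot mulr_suml; apply: eq_bigr => i _.
  by rewrite -mulr_sumr; congr (_ * _); apply: eq_bigr => j _ //; apply: eq_bigr.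
by apply: ler_sum => z _; exact: sum_cauchy_schwarz.
Qed.

(** Only the upper half of a cut norm bound on [A - W], which is what an upper
    bound on triangle counts uses. *)
Definition cut_bounded (eps : R) A W := forall S T : {set I},
  \sum_(i in S) \sum_(j in T) (A i j - W i j) <= eps.

Lemma sum_weight_le_sum_pos (a w : I -> R) : (forall i, 0 <= w i <= 1) ->
  \sum_i w i * a i <= \sum_(i in [set i | 0 <= a i]%SET) a i.
Proof.
move=> w01; rewrite [leRHS]big_mkcond /=; apply: ler_sum => i _.
rewrite inE; have /andP[w0 w1] := w01 i.
by case: ifPn => [a0|]; [rewrite ler_piMl | rewrite -ltNge => /ltW ?; rewrite mulr_ge0_le0].
Qed.

(** The sum is affine in each weight separately, so it is largest at weights
    that are indicators of sets. *)
Lemma cut_bounded_weights eps A W (u v : I -> R) : cut_bounded eps A W ->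
  (forall i, 0 <= u i <= 1) -> (forall i, 0 <= v i <= 1) ->
  \sum_i \sum_j (A i j - W i j) * (u i * v j) <= eps.
Proof.
move=> cutAW u01 v01.
have -> : \sum_i \sum_j (A i j - W i j) * (u i * v j) =
    \sum_i u i * (\sum_j (A i j - W i j) * v j).
  by apply: eq_bigr => i _; rewrite mulr_sumr; apply: eq_bigr => j _; ring.
apply: le_trans (sum_weight_le_sum_pos _ u01) _.
set S := [set i | _]%SET.
have -> : \sum_(i in S) \sum_j (A i j - W i j) * v j =
    \sum_j v j * (\sum_(i in S) (A i j - W i j)).
  rewrite exchange_big /=; apply: eq_bigr => j _.
  by rewrite mulr_sumr; apply: eq_bigr => i _; ring.
apply: le_trans (sum_weight_le_sum_pos _ v01) _.
by rewrite exchange_big; exact: cutAW.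
Qed.

(** The three factors are replaced one at a time: once the vertex outside the
    replaced pair is fixed, the two other factors are weights on its ends. *)
Lemma kernel_triangle_counting eps A W : cut_bounded eps A W ->
  (forall i j, 0 <= A i j <= 1) -> (forall i j, 0 <= W i j <= 1) ->
  kernel_triangle A <= kernel_triangle W + 3 * (#|I|%:R * eps).
Proof.
move=> cutAW A01 W01.
have card_eps : \sum_(i : I) eps = #|I|%:R * eps by rewrite sumr_const mulr_natl.
pose T1 := \sum_i \sum_j \sum_k W i j * A j k * A i k.
pose T2 := \sum_i \sum_j \sum_k W i j * W j k * A i k.
have AT1 : kernel_triangle A - T1 <= #|I|%:R * eps.
  rewrite -card_eps.
  have -> : kernel_triangle A - T1 =
      \sum_k \sum_i \sum_j (A i j - W i j) * (A i k * A j k).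
    rewrite /kernel_triangle /T1 -sumrB [RHS]exchange_big /=; apply: eq_bigr => i _.
    rewrite -sumrB [RHS]exchange_big /=; apply: eq_bigr => j _.
    by rewrite -sumrB; apply: eq_bigr => k _; ring.
  by apply: ler_sum => k _; exact: cut_bounded_weights.
have T12 : T1 - T2 <= #|I|%:R * eps.
  rewrite -card_eps.
  have -> : T1 - T2 = \sum_i \sum_j \sum_k (A j k - W j k) * (W i j * A i k).
    rewrite /T2 /T1 -sumrB; apply: eq_bigr => i _.
    rewrite -sumrB; apply: eq_bigr => j _.
    by rewrite -sumrB; apply: eq_bigr => k _; ring.
  by apply: ler_sum => k _; exact: cut_bounded_weights.
have T2W : T2 - kernel_triangle W <= #|I|%:R * eps.
  rewrite -card_eps.
  have -> : T2 - kernel_triangle W =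
      \sum_j \sum_i \sum_k (A i k - W i k) * (W i j * W j k).
    rewrite /kernel_triangle /T2 -sumrB [RHS]exchange_big /=; apply: eq_bigr => i _.
    rewrite -sumrB; apply: eq_bigr => j _.
    by rewrite -sumrB; apply: eq_bigr => k _; ring.
  by apply: ler_sum => k _; exact: cut_bounded_weights.
lra.
Qed.

(** One step of the energy decrement that builds an approximation of a kernel:
    [Some (U, V)] raises it on the rectangle [U * V], and [None] shrinks it
    towards zero. A step depends on [O(#|I|)] bits only, so that bounded
    sequences of steps describe few kernels. *)
Definition refinement := option ({set I} * {set I}).

Definition apply_refinement (eps : R) (o : refinement) W : I -> I -> R :=
  if o is Some (U, V) then
    fun i j => Num.min 1 (W i j + eps * ((i \in U) && (j \in V))%:R)
  else fun i j => (1 - eps) * W i j.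

Definition approximant (eps : R) (s : seq refinement) : I -> I -> R :=
  foldr (apply_refinement eps) (fun _ _ => 0) s.

Lemma approximant_itv eps s : 0 <= eps <= 1 ->
  forall i j, 0 <= approximant eps s i j <= 1.
Proof.
move=> /andP[e0 e1]; elim: s => [|[[S T]|] s IH] i j /=; first by rewrite lexx ler01.
  have /andP[W0 W1] := IH i j.
  rewrite le_min ler01 ge_min lexx /= andbT addr_ge0// mulr_ge0//.
have /andP[W0 W1] := IH i j.
by rewrite mulr_ge0 ?subr_ge0//= mulr_ile1// ?subr_ge0// lerBlDr lerDl.
Qed.

(** The second condition, a bound on [<W, W - A>], makes the energy of [W] at
    most [2 * <A, W> - |W|^2] up to a small error; the latter is affine in
    [A]. *)
Definition good_approx (eps : R) A W :=
  cut_bounded (eps * #|I|%:R ^+ 2) A W /\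
  kernel_dot W W - kernel_dot A W <= eps * #|I|%:R ^+ 2.

Definition sqdist A W := \sum_i \sum_j (A i j - W i j) ^+ 2.

Lemma sum_const2 (x : R) : \sum_(i : I) \sum_(j : I) x = x * #|I|%:R ^+ 2.
Proof. by rewrite sumr_const sumr_const -mulrnA -(mulr_natr x) natrM expr2. Qed.

(** Truncation at [1] only decreases the distance to [A <= 1]. Without it, the
    square expands into a gain of [2 * eps] times the violation, which exceeds
    [eps * #|I|^2], and a loss of at most [eps^2 * #|I|^2]. *)
Lemma sqdist_refine_cut eps A W (S T : {set I}) : 0 <= eps ->
  (forall i j, 0 <= A i j <= 1) ->
  eps * #|I|%:R ^+ 2 < \sum_(i in S) \sum_(j in T) (A i j - W i j) ->
  sqdist A (apply_refinement eps (Some (S, T)) W) <= sqdist A W - eps ^+ 2 * #|I|%:R ^+ 2.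
Proof.
move=> e0 A01 big.
pose d i j := ((i \in S) && (j \in T))%:R : R.
have sumE : \sum_(i in S) \sum_(j in T) (A i j - W i j) =
    \sum_i \sum_j d i j * (A i j - W i j).
  rewrite big_mkcond /=; apply: eq_bigr => i _.
  rewrite /d; case: (i \in S) => /=; last by rewrite big1// => j _; rewrite mul0r.
  by rewrite big_mkcond /=; apply: eq_bigr => j _; case: (j \in T); rewrite ?mul1r ?mul0r.
have : sqdist A (apply_refinement eps (Some (S, T)) W) <= sqdist A W
    - 2 * eps * \sum_i \sum_j d i j * (A i j - W i j) + \sum_(i : I) \sum_(j : I) eps ^+ 2.
  rewrite /sqdist !mulr_sumr -sumrB -big_split /=; apply: ler_sum => i _.
  rewrite !mulr_sumr -sumrB -big_split /=; apply: ler_sum => j _.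
  have /andP[A0 A1] := A01 i j; rewrite -/(d i j).
  have dd : d i j * d i j <= 1 by rewrite /d; case: (_ && _); rewrite ?mul0r ?mulr1.
  have ed : eps ^+ 2 * (d i j * d i j) <= eps ^+ 2 by rewrite ler_piMr// sqr_ge0.
  rewrite minEle; case: ifPn => [le1|_]; nra.
rewrite -sumE sum_const2 => /le_trans; apply.
nra.
Qed.

Lemma sqdist_refine_shrink eps A W : 0 <= eps ->
  (forall i j, 0 <= W i j <= 1) ->
  eps * #|I|%:R ^+ 2 < kernel_dot W W - kernel_dot A W ->
  sqdist A (apply_refinement eps None W) <= sqdist A W - eps ^+ 2 * #|I|%:R ^+ 2.
Proof.
move=> e0 W01 big.
have : sqdist A (apply_refinement eps None W) <= sqdist A W
    - 2 * eps * (kernel_dot W W - kernel_dot A W) + \sum_(i : I) \sum_(j : I) eps ^+ 2.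
  rewrite /sqdist /kernel_dot -sumrB !mulr_sumr -sumrB -big_split /=.
  apply: ler_sum => i _; rewrite -sumrB !mulr_sumr -sumrB -big_split /=.
  apply: ler_sum => j _; have /andP[W0 W1] := W01 i j.
  have WW : eps ^+ 2 * (W i j * W i j) <= eps ^+ 2.
    by rewrite ler_piMr ?sqr_ge0// mulr_ile1.
  nra.
rewrite sum_const2 => /le_trans; apply; nra.
Qed.

Lemma apply_refinement_nop eps W : (forall i j, W i j <= 1) ->
  apply_refinement eps (Some (finset.set0, finset.set0)) W = W.
Proof.
move=> W1; apply/funext => i; apply/funext => j /=.
by rewrite !inE /= mulr0 addr0 min_r.
Qed.

(** As long as the approximation is not good, a step decreases the squared
    distance to [A] by [eps^2 * #|I|^2]. Once it is good, the sequence is padded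
    to length [k] with the neutral step on the empty rectangle. *)
Lemma good_approx_or_close eps A k : 0 <= eps <= 1 -> (forall i j, 0 <= A i j <= 1) ->
  exists2 s : seq refinement, size s = k & good_approx eps A (approximant eps s) \/
    sqdist A (approximant eps s) <= (1 - k%:R * eps ^+ 2) * #|I|%:R ^+ 2.
Proof.
move=> eps01 A01; have /andP[e0 e1] := eps01; elim: k => [|k [s sk IH]].
  exists [::] => //; right; rewrite mul0r subr0 -sum_const2.
  apply: ler_sum => i _; apply: ler_sum => j _ /=; have /andP[A0 A1] := A01 i j.
  by rewrite subr0 expr_le1.
have W01 := approximant_itv s eps01.
have [good|notgood] := EM (good_approx eps A (approximant eps s)).
  exists (Some (finset.set0, finset.set0) :: s); first by rewrite /= sk.
  left; rewrite [approximant _ _](_ : _ = approximant eps s)//.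
  by apply: apply_refinement_nop => i j; have /andP[] := W01 i j.
case: IH => [//|close].
have [r hr] : exists r, sqdist A (apply_refinement eps r (approximant eps s))
     <= sqdist A (approximant eps s) - eps ^+ 2 * #|I|%:R ^+ 2.
  set W := approximant eps s.
  have [dotW|dotW] := leP (kernel_dot W W - kernel_dot A W) (eps * #|I|%:R ^+ 2);
    last by exists None; exact: sqdist_refine_shrink.
  have [S [T ST]] : exists S T : {set I}, eps * #|I|%:R ^+ 2 <
      \sum_(i in S) \sum_(j in T) (A i j - approximant eps s i j).
    apply: contrapT => noST; apply: notgood; split => // S T.
    by rewrite leNgt; apply/negP => ST; apply: noST; exists S, T.
  by exists (Some (S, T)); exact: sqdist_refine_cut.
exists (r :: s); first by rewrite /= sk.
right; apply: le_trans hr _; rewrite -[k.+1]addn1 natrD; nra.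
Qed.

Lemma exists_good_approx eps A k : 0 <= eps <= 1 -> (0 < #|I|)%N ->
  1 < k%:R * eps ^+ 2 -> (forall i j, 0 <= A i j <= 1) ->
  exists s : k.-tuple refinement, good_approx eps A (approximant eps s).
Proof.
move=> eps01 I0 keps A01; have [s sk [good|close]] := good_approx_or_close k eps01 A01.
  by have /eqP sk' := sk; exists (Tuple sk').
have d0 : 0 <= sqdist A (approximant eps s).
  by apply: sumr_ge0 => i _; apply: sumr_ge0 => j _; exact: sqr_ge0.
have := le_trans d0 close; rewrite pmulr_lge0 ?exprn_gt0 ?ltr0n// subr_ge0.
by rewrite leNgt keps.
Qed.

Lemma kernel_triangle_itv W : (forall i j, 0 <= W i j <= 1) ->
  0 <= kernel_triangle W <= #|I|%:R ^+ 3.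
Proof.
move=> W01; apply/andP; split.
  apply: sumr_ge0 => i _; apply: sumr_ge0 => j _; apply: sumr_ge0 => l _.
  have /andP[Wij _] := W01 i j; have /andP[Wjl _] := W01 j l.
  by have /andP[Wil _] := W01 i l; rewrite !mulr_ge0.
have -> : #|I|%:R ^+ 3 = \sum_(i : I) \sum_(j : I) \sum_(k : I) 1 :> R.
  rewrite exprSr -(mul1r (#|I|%:R ^+ 2)) -sum_const2 mulr_suml; apply: eq_bigr => i _.
  by rewrite mulr_suml; apply: eq_bigr => j _; rewrite sumr_const mul1r.
apply: ler_sum => i _; apply: ler_sum => j _; apply: ler_sum => l _.
have /andP[? ?] := W01 i j; have /andP[? ?] := W01 j l; have /andP[? ?] := W01 i l.
by rewrite !mulr_ile1// mulr_ge0.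
Qed.

(** For the adjacency kernel of a graph, the energy of [A] itself is only the
    number of edges; the energy of a good approximation is the quantity that
    the Bernoulli large deviations can pay for. *)
Lemma kernel_triangle_le_energy eps A k : 0 <= eps <= 1 -> (0 < #|I|)%N ->
  1 < k%:R * eps ^+ 2 -> (forall i j, 0 <= A i j <= 1) ->
  exists s : k.-tuple refinement, let W := approximant eps s in
    [/\ 0 <= kernel_dot W W,
        kernel_dot W W <= 2 * kernel_dot A W - kernel_dot W W + 2 * eps * #|I|%:R ^+ 2 &
    kernel_triangle A ^+ 2 <=
      kernel_dot W W ^+ 3 + 15 * eps * #|I|%:R ^+ 6].
Proof.
move=> eps01 I0 keps A01; have [s [cutAW dotW]] := exists_good_approx eps01 I0 keps A01.
exists s => W; have W01 := approximant_itv s eps01; have /andP[e0 e1] := eps01.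
have W0 : 0 <= kernel_dot W W.
  by apply: sumr_ge0 => i _; apply: sumr_ge0 => j _; rewrite -expr2 sqr_ge0.
split => //; first by rewrite -/W in dotW; lra.
have TA := kernel_triangle_counting cutAW A01 W01.
have TW := kernel_triangle_cauchy_schwarz W.
set n := #|I|%:R in TA *; rewrite -/W in TA.
have n0 : 0 <= n by rewrite ler0n.
have /andP[TW0 TW1] := kernel_triangle_itv W01.
have /andP[TA0 TA1] := kernel_triangle_itv A01.
rewrite -/W -/n in TW0 TW1 TA0 TA1.
have {}TA : kernel_triangle A <= kernel_triangle W + 3 * eps * n ^+ 3.
  by apply: le_trans TA _; rewrite lerD2l; nra.
apply: le_trans (_ : (kernel_triangle W + 3 * eps * n ^+ 3) ^+ 2 <= _).
  by rewrite lerXn2r// nnegrE// addr_ge0// !mulr_ge0// exprn_ge0.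
have n3 : 0 <= n ^+ 3 by rewrite exprn_ge0.
have -> : n ^+ 6 = n ^+ 3 * n ^+ 3 by rewrite -exprD.
set m := n ^+ 3 in TW1 n3 *; set tW := kernel_triangle W in TW TW0 TW1 *.
(* In the square [(tW + 3 * eps * m)^2] the cross term is at most [6 * eps * m^2],
   as [tW <= m], and the last term at most [9 * eps * m^2]; hence [15]. *)
have h1 : eps * (tW * m) <= eps * (m * m) by rewrite ler_wpM2l// ler_wpM2r.
have h2 : eps * eps * (m * m) <= eps * (m * m).
  by rewrite -mulrA ler_wpM2l// ler_piMl// mulr_ge0.
apply: le_trans (_ : tW ^+ 2 + 15 * eps * (m * m) <= _); last by rewrite lerD2r.
nra.
Qed.

End FiniteKernels.

Arguments refinement I : clear implicits.

(** * The Erdos-Renyi law as a product measure *)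

Section ProductMeasure.
Context {R : realType} {n : nat}.
Implicit Types (p s : R) (X : sgraph n).

Lemma erdos_renyi_prod p (g : potential_edge n -> bool -> R) :
  \sum_X erdos_renyi p X * \prod_e g e (X e) =
  \prod_e (p * g e true + (1 - p) * g e false).
Proof.
have -> : \prod_e (p * g e true + (1 - p) * g e false) =
    \prod_e \sum_b (if b then p else 1 - p) * g e b.
  by apply: eq_bigr => e _; rewrite big_bool.
rewrite bigA_distr_bigA; apply: eq_bigr => X _.
by rewrite /erdos_renyi -big_split.
Qed.

Lemma sum_erdos_renyi p : \sum_(X : sgraph n) erdos_renyi p X = 1.
Proof.
transitivity (\sum_(X : sgraph n) erdos_renyi p X * \prod_(e : potential_edge n) 1).
  by apply: eq_bigr => X _; rewrite big1// mulr1.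
rewrite (erdos_renyi_prod p (fun _ _ => 1)) big1// => e _; ring.
Qed.

Lemma erdos_renyi_gt0 p X : 0 < p < 1 -> 0 < erdos_renyi p X.
Proof.
by move=> /andP[p0 p1]; apply: prodr_gt0 => e _; case: (X e); rewrite ?subr_gt0.
Qed.

Definition edge_count X : R := \sum_e (X e)%:R.

Definition num_edges : R := #|{: potential_edge n}|%:R.

Lemma num_edgesE : num_edges = n%:R * (n%:R - 1) / 2.
Proof.
rewrite /num_edges card_sig -cardsE card_draws card_ord.
have := mul_bin_diag n 1; rewrite bin1 => /(congr1 (fun k => k%:R : R)).
case: n => [|k]; first by rewrite !mul0r.
rewrite !natrM /= -[k.+1]addn1 natrD => h.
by apply/(@mulfI _ 2) => //; rewrite -h; field.
Qed.

(** The likelihood depends on the graph through its number of edges only. This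
    makes the edge term of the tilt a mere change of [p], and it makes changes
    of measure between two edge probabilities explicit. *)
Lemma erdos_renyi_exp p X : 0 < p < 1 ->
  erdos_renyi p X = expR (num_edges * ln (1 - p) + logit p * edge_count X).
Proof.
move=> /andP[p0 p1]; have q0 : 0 < 1 - p by rewrite subr_gt0.
rewrite /num_edges -sum1_card natr_sum mulr_suml mulr_sumr -big_split/= expR_sum.
apply: eq_bigr => e _; rewrite mul1r /logit; case: (X e).
  by rewrite mulr1 -lnM ?posrE ?divr_gt0// mulrC divfK ?lt0r_neq0// lnK.
by rewrite mulr0 addr0 lnK.
Qed.

Definition adjacency X (i j : 'I_n) : R := (adj X i j)%:R.

Lemma adjacency_itv X i j : 0 <= adjacency X i j <= 1.
Proof. by rewrite /adjacency; case: adj; rewrite lexx ler01. Qed.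

(** At most one potential edge has the ends [i] and [j]. *)
Lemma adjacencyE X i j :
  adjacency X i j = \sum_e (X e)%:R * (val e == [set i; j]%SET)%:R.
Proof.
rewrite /adjacency /adj; case: existsP => [[e /andP[/eqP eij Xe]]|noe].
  rewrite (bigD1 e)//= eij eqxx Xe mulr1 big1 ?addr0// => f fe.
  case: eqP => [fij|_]; last by rewrite mulr0.
  by move: fe; rewrite -val_eqE /= fij -eij eqxx.
rewrite big1// => e _; case: (boolP (X e)) => Xe; last by rewrite mul0r.
case: eqP => [eij|_]; last by rewrite mulr0.
by case: noe; exists e; rewrite eij eqxx Xe.
Qed.

Lemma adjacency_sym X i j : adjacency X i j = adjacency X j i.
Proof. by rewrite !adjacencyE; apply: eq_bigr => e _; rewrite finset.setUC. Qed.

Definition pair_sum (e : potential_edge n) (W : 'I_n -> 'I_n -> R) : R :=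
  \sum_i \sum_j (val e == [set i; j]%SET)%:R * W i j.

Lemma pair_sumE (e : potential_edge n) : exists2 ab : 'I_n * 'I_n, ab.1 != ab.2 &
  forall W, pair_sum e W = W ab.1 ab.2 + W ab.2 ab.1.
Proof.
have /cards2P[a [b [ab eab]]] := valP e.
exists (a, b) => //= W; rewrite /pair_sum pair_bigA /=.
rewrite (bigD1 (a, b))//= (bigD1 (b, a))/=; last by rewrite xpair_eqE eq_sym (negPf ab).
have -> : (val e == [set a; b]%SET) = true by rewrite eab eqxx.
have -> : (val e == [set b; a]%SET) = true by rewrite eab finset.setUC eqxx.
rewrite !mul1r big1 ?addr0// => -[i j] /andP[ijab ijba] /=.
case: eqP => [|_]; last by rewrite mul0r.
rewrite eab => abij.
have /set2P[ia|ib] : i \in [set a; b]%SET by rewrite abij set21.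
  have : b \in [set i; j]%SET by rewrite -abij set22.
  rewrite ia => /set2P[ba|bj]; first by rewrite ba eqxx in ab.
  by rewrite ia bj eqxx in ijab.
have : a \in [set i; j]%SET by rewrite -abij set21.
rewrite ib => /set2P[ba|aj]; first by rewrite ba eqxx in ab.
by rewrite ib aj eqxx in ijba.
Qed.

Lemma kernel_dot_adjacency X W :
  kernel_dot (adjacency X) W = \sum_e (X e)%:R * pair_sum e W.
Proof.
rewrite /kernel_dot /pair_sum.
under [RHS]eq_bigr do rewrite mulr_sumr.
rewrite [RHS]exchange_big; apply: eq_bigr => i _.
under [RHS]eq_bigr do rewrite mulr_sumr.
rewrite [RHS]exchange_big; apply: eq_bigr => j _.
by rewrite adjacencyE mulr_suml; apply: eq_bigr => e _; rewrite mulrA.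
Qed.

Lemma kernel_sum_adjacency X :
  \sum_i \sum_j adjacency X i j = 2 * edge_count X.
Proof.
transitivity (kernel_dot (adjacency X) (fun _ _ => 1)).
  by apply: eq_bigr => i _; apply: eq_bigr => j _; rewrite mulr1.
rewrite kernel_dot_adjacency /edge_count mulr_sumr; apply: eq_bigr => e _.
by have [ab _ ->] := pair_sumE e; rewrite mulrC.
Qed.

(** Each edge collects two entries of [W], hence the factor [2]. *)
Lemma sum_pair_sum_sqr_le (W : 'I_n -> 'I_n -> R) :
  \sum_e pair_sum e W ^+ 2 <= 2 * kernel_dot W W.
Proof.
pose W2 i j := W i j * W i j.
have -> : 2 * kernel_dot W W = 2 * \sum_i \sum_j 1 * W2 i j.
  by congr (_ * _); apply: eq_bigr => i _; apply: eq_bigr => j _; rewrite mul1r.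
apply: le_trans (_ : \sum_e 2 * pair_sum e W2 <= _).
  apply: ler_sum => e _; have [ab _ abE] := pair_sumE e; rewrite !abE /W2.
  have := sqr_ge0 (W ab.1 ab.2 - W ab.2 ab.1); nra.
rewrite -mulr_sumr ler_pM2l// /pair_sum exchange_big /=; apply: ler_sum => i _.
rewrite exchange_big /=; apply: ler_sum => j _.
rewrite -mulr_suml ler_wpM2r//; first by rewrite /W2 -expr2 sqr_ge0.
have [[e eij]|noe] := EM (exists e : potential_edge n, val e = [set i; j]%SET).
  rewrite (bigD1 e)//= eij eqxx big1 ?addr0// => f fe.
  by case: eqP => // fij; move: fe; rewrite -val_eqE /= fij -eij eqxx.
by rewrite big1// => e _; case: eqP => // eij; case: noe; exists e.
Qed.

End ProductMeasure.

Arguments num_edges {R} n.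

(** * Relative entropy of Bernoulli laws *)

Section Entropy.
Context {R : realType}.
Implicit Types p s t u : R.

Lemma sub_le_mul_ln (a b : R) : 0 <= a -> 0 < b -> a - b <= a * ln (a / b).
Proof.
rewrite le_eqVlt => /predU1P[<- b0|a0 b0]; first by rewrite mul0r sub0r oppr_le0 ltW.
have := @le_ln1Dx R (b / a - 1).
rewrite [1 + _]addrC subrK => h.
have {}h : ln (b / a) <= b / a - 1 by apply: h; rewrite ltrBrDr addNr divr_gt0.
rewrite -[a / b]invf_div lnV ?posrE ?divr_gt0// mulrN lerNr opprB.
apply: le_trans (_ : a * (b / a - 1) <= _); rewrite ?ler_pM2l//.
  by rewrite mulrBr mulr1 mulrC divfK ?lt0r_neq0.
Qed.

Lemma sub_lt_mul_ln (a b : R) : 0 < a -> 0 < b -> a != b -> a - b < a * ln (a / b).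
Proof.
move=> a0 b0 ab; have ba0 : 0 < b / a by rewrite divr_gt0.
have : ln (b / a) != 0.
  by rewrite ln_eq0//; apply: contra_neq ab => h; rewrite -[b](divfK (lt0r_neq0 a0)) h mul1r.
move=> /expR_gt1Dx; rewrite lnK ?posrE// => h.
rewrite -[a / b]invf_div lnV ?posrE// mulrN ltrNr opprB.
have : a * (1 + ln (b / a)) < a * (b / a) by rewrite ltr_pM2l.
by rewrite mulrDr mulr1 [a * (b / a)]mulrC divfK ?lt0r_neq0// => {}h; lra.
Qed.

Lemma rate_ge0 p u : 0 < p < 1 -> 0 <= u <= 1 -> 0 <= rate p u.
Proof.
move=> /andP[p0 p1] /andP[u0 u1]; have q0 : 0 < 1 - p by rewrite subr_gt0.
have v0 : 0 <= 1 - u by rewrite subr_ge0.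
have := sub_le_mul_ln u0 p0; have := sub_le_mul_ln v0 q0.
by rewrite /rate => ? ?; rewrite mulr_ge0 ?invr_ge0//; lra.
Qed.

Lemma rate_gt0 p u : 0 < p < 1 -> 0 < u < 1 -> u != p -> 0 < rate p u.
Proof.
move=> /andP[p0 p1] /andP[u0 u1] up; have q0 : 0 < 1 - p by rewrite subr_gt0.
have v0 : 0 <= 1 - u by rewrite subr_ge0 ltW.
have := sub_lt_mul_ln u0 p0 up; have := sub_le_mul_ln v0 q0.
by rewrite /rate => ? ?; rewrite mulr_gt0 ?invr_gt0//; lra.
Qed.

Lemma rateE p u : 0 < p < 1 -> 0 < u < 1 ->
  rate p u = 2^-1 * (u * (ln u - ln p) + (1 - u) * (ln (1 - u) - ln (1 - p))).
Proof.
by move=> /andP[? ?] /andP[? ?]; rewrite /rate !ln_div ?posrE ?subr_gt0.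
Qed.

Lemma logitE u : 0 < u < 1 -> logit u = ln u - ln (1 - u).
Proof. by move=> /andP[? ?]; rewrite /logit ln_div ?posrE ?subr_gt0. Qed.

(** The error of the tangent of [rate p] at [s] is again a relative entropy, so
    it is nonnegative; this gives the convexity of [rate p]. *)
Lemma rate_three_points p s t : 0 < p < 1 -> 0 < s < 1 -> 0 < t < 1 ->
  rate p t = rate p s + (logit s - logit p) / 2 * (t - s) + rate s t.
Proof. by move=> p01 s01 t01; rewrite !rateE// !logitE//; field. Qed.

Lemma ltr_logit p t : 0 < p -> p < t -> t < 1 -> logit p < logit t.
Proof.
move=> p0 pt t1; have p1 := lt_trans pt t1; have t0 := lt_trans p0 pt.
rewrite !logitE ?p0 ?t0//.
have : ln p < ln t by rewrite ltr_ln ?posrE.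
have : ln (1 - t) < ln (1 - p) by rewrite ltr_ln ?posrE ?subr_gt0// ltrD2l ltrN2.
lra.
Qed.

Lemma bernoulli_mgf_tilt p u : 0 < p < 1 -> 0 < u < 1 ->
  let th := logit u - logit p in
  1 - p + p * expR th = expR (th * u - 2 * rate p u).
Proof.
move=> p01 u01 th; have /andP[p0 p1] := p01; have /andP[u0 u1] := u01.
have -> : th * u - 2 * rate p u = ln (1 - p) - ln (1 - u).
  by rewrite /th rateE// !logitE//; field.
have -> : th = ln u - ln (1 - u) - (ln p - ln (1 - p)) by rewrite /th !logitE.
rewrite !expRB !lnK ?posrE ?subr_gt0//.
by field; rewrite !lt0r_neq0 ?subr_gt0.
Qed.

(** The maximum in the Legendre duality between [rate p] and the cumulant
    generating function is attained, at the mean of the tilted law. *)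
Lemma bernoulli_mgf_variational p (th : R) : 0 < p < 1 ->
  exists2 u, 0 < u < 1 & 1 - p + p * expR th = expR (th * u - 2 * rate p u).
Proof.
move=> p01; have /andP[p0 p1] := p01.
have e0 := expR_gt0 th; set m := 1 - p + p * expR th.
have pe0 : 0 < p * expR th by rewrite mulr_gt0.
have m0 : 0 < m by rewrite addr_gt0 ?subr_gt0.
pose u := p * expR th / m.
have u1 : 1 - u = (1 - p) / m by rewrite /u /m; field; rewrite lt0r_neq0.
have u01 : 0 < u < 1.
  by rewrite divr_gt0//= -subr_gt0 u1 divr_gt0// subr_gt0.
exists u => //; have := bernoulli_mgf_tilt p01 u01.
suff -> : logit u - logit p = th by [].
have q0 : 0 < 1 - p by rewrite subr_gt0.
rewrite !logitE// u1 /u !ln_div ?posrE// lnM ?posrE// expRK; ring.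
Qed.

(** In the variable [x = u ^+ 2] this says that the line of slope [c] through
    [t ^+ 2] stays below the function [x |-> rate p (sqrt x)]. *)
Definition quadratic_minorant p t (c : R) := forall u, 0 <= u <= 1 ->
  rate p t + c * (u ^+ 2 - t ^+ 2) <= rate p u.

(** Legendre duality turns a lower bound on the rate by a parabola into an upper
    bound on the moment generating function by a Gaussian one, through
    [4 * c * w * u <= 2 * c * w^2 + 2 * c * u^2]. *)
Lemma bernoulli_mgf_quadratic p t c (w : R) : 0 < p < 1 -> 0 < c ->
  quadratic_minorant p t c ->
  1 - p + p * expR (4 * c * w) <=
    expR (2 * c * w ^+ 2 + 2 * (c * t ^+ 2 - rate p t)).
Proof.
move=> p01 c0 minor; have [u /andP[u0 u1] ->] := bernoulli_mgf_variational (4 * c * w) p01.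
have /minor h : 0 <= u <= 1 by rewrite !ltW.
rewrite ler_expR.
have : 0 <= c * (w - u) ^+ 2 by rewrite mulr_ge0 ?sqr_ge0// ltW.
nra.
Qed.

Lemma continuous_rate p t : 0 < p < 1 -> 0 < t < 1 ->
  rate p x @[x --> t] --> rate p t.
Proof.
move=> /andP[p0 p1] /andP[t0 t1]; rewrite /rate.
have q0 : 0 < 1 - p by rewrite subr_gt0.
have v0 : 0 < 1 - t by rewrite subr_gt0.
apply: cvgM; first exact: cvg_cst.
apply: cvgD; (apply: cvgM; first by try apply: cvgB => //; try exact: cvg_cst; exact: cvg_id).
  apply: continuous_cvg; first by apply: continuous_ln; rewrite divr_gt0.
  by apply: cvgM; [exact: cvg_id|exact: cvg_cst].
apply: continuous_cvg; first by apply: continuous_ln; rewrite divr_gt0.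
apply: cvgM; last exact: cvg_cst.
by apply: cvgB; [exact: cvg_cst|exact: cvg_id].
Qed.

Lemma continuous_logit t : 0 < t < 1 -> logit x @[x --> t] --> logit t.
Proof.
move=> /andP[t0 t1]; rewrite /logit.
have v0 : 0 < 1 - t by rewrite subr_gt0.
apply: continuous_cvg; first by apply: continuous_ln; rewrite divr_gt0.
apply: cvgM; first exact: cvg_id.
apply: cvgV; first by rewrite lt0r_neq0.
by apply: cvgB; [exact: cvg_cst|exact: cvg_id].
Qed.

(** The premise with [q = m * (1 - m)] is the minimality of the constant [t]
    among the two-block graphons of parts [m] and [1 - m], with value [s] inside
    the parts and [r] between them. If [r] violated the conclusion, take
    [s = t + q * v] with [v] slightly above the value that keeps the triangle
    density at [t ^+ 3] to first order in [q]. As [q] tends to [0], the rate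
    would then change by [- q * gap] to first order and the density would
    increase. *)
Lemma two_block_tangent p t : 0 < p -> p < t -> t < 1 ->
  (forall q r s, 0 < q <= 4^-1 -> 0 <= r <= 1 -> 0 <= s <= 1 ->
     t ^+ 3 <= s ^+ 3 + 3 * q * s * (r ^+ 2 - s ^+ 2) ->
     rate p t <= rate p s + 2 * q * (rate p r - rate p s)) ->
  quadratic_minorant p t ((logit t - logit p) / (4 * t)).
Proof.
move=> p0 pt t1 two_block r r01; set c := _ / (4 * t).
have t0 : 0 < t := lt_trans p0 pt.
have p01 : 0 < p < 1 by rewrite p0 (lt_trans pt).
have t01 : 0 < t < 1 by rewrite t0.
have h0 : 0 < logit t - logit p by rewrite subr_gt0 ltr_logit.
rewrite leNgt; apply/negP => below.
pose gap := rate p t + c * (r ^+ 2 - t ^+ 2) - rate p r.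
have gap0 : 0 < gap by rewrite subr_gt0.
(* The choice of [eta] makes the limit of [G], the rate change per [q],
   equal to [- gap], while [F] tends to [t ^+ 2 * eta > 0]. *)
pose eta := gap / ((logit t - logit p) / 2).
have eta0 : 0 < eta by rewrite !divr_gt0.
pose v := eta - (r ^+ 2 - t ^+ 2) / t.
pose s q := t + q * v.
have s_cvg : s q @[q --> 0^'+] --> t.
  rewrite -[X in _ --> X]addr0 -[X in t + X](mul0r v).
  apply: cvgD; first exact: cvg_cst.
  by apply: cvgM; [exact: cvg_at_right_filter cvg_id|exact: cvg_cst].
have q_cvg : (fun q : R => q) @ 0^'+ --> (0 : R) by exact: cvg_at_right_filter cvg_id.
pose F q := t ^+ 2 * v + t * q * v ^+ 2 + q ^+ 2 * v ^+ 3 / 3 + s q * (r ^+ 2 - s q ^+ 2).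
have F_cvg : F q @[q --> 0^'+] --> t ^+ 2 * eta.
  have -> : t ^+ 2 * eta = t ^+ 2 * v + t * 0 * v ^+ 2 + 0 ^+ 2 * v ^+ 3 / 3
      + t * (r ^+ 2 - t ^+ 2) by rewrite /v; field; rewrite lt0r_neq0.
  by repeat first [exact: s_cvg | exact: q_cvg | exact: cvg_cst | apply: cvgD
    | apply: cvgN | apply: cvgM | apply: exprn_continuous].

pose G q := (logit (s q) - logit p) / 2 * v + 2 * (rate p r - rate p (s q)).
have G_cvg : G q @[q --> 0^'+] --> - gap.
  have -> : - gap = (logit t - logit p) / 2 * v + 2 * (rate p r - rate p t).
    by rewrite /v /eta /gap /c; field; rewrite !lt0r_neq0.
  apply: cvgD; apply: cvgM; try exact: cvg_cst.
    apply: cvgM; last exact: cvg_cst.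
    apply: cvgB; last exact: cvg_cst.
    by apply: continuous_cvg s_cvg; exact: continuous_logit.
  apply: cvgB; first exact: cvg_cst.
  by apply: continuous_cvg s_cvg; exact: continuous_rate.
have : \forall q \near (0 : R)^'+, False; last by move/filter_ex => [].
near=> q.
have q0 : 0 < q by near: q; exact: nbhs_right_gt.
have q4 : q <= 4^-1 by near: q; apply: nbhs_right_le; rewrite invr_gt0.
have Fq : 0 < F q.
  by near: q; apply: (cvgr_gt _ F_cvg); rewrite mulr_gt0// exprn_gt0.
have Gq : G q < 0 by near: q; apply: (cvgr_lt _ G_cvg); rewrite oppr_lt0.
have sq0 : 0 < s q by near: q; exact: (cvgr_gt _ s_cvg).
have sq1 : s q < 1 by near: q; exact: (cvgr_lt _ s_cvg).
have sq01 : 0 < s q < 1 by rewrite sq0.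
have h : rate p t <= rate p (s q) + 2 * q * (rate p r - rate p (s q)).
  apply: two_block; rewrite ?q0 ?(ltW sq0) ?(ltW sq1)//.
  rewrite -subr_ge0.
  have -> : s q ^+ 3 + 3 * q * s q * (r ^+ 2 - s q ^+ 2) - t ^+ 3 = 3 * q * F q.
    by rewrite /F /s; field.
  by rewrite ltW// !mulr_gt0.
have conv := rate_three_points p01 sq01 t01.
have st0 : 0 <= rate (s q) t by apply: rate_ge0 => //; rewrite !ltW.
have stq : t - s q = - (q * v) by rewrite /s; ring.
have : 0 <= q * G q by rewrite /G; rewrite stq in conv; nra.
by rewrite pmulr_rge0// leNgt Gq.
Unshelve. all: by end_near.
Qed.

End Entropy.

(** * Graphons constant on blocks *)

Section BlockFunctions.
Context {R : realType} {J : finType}.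
Notation mu := (@lebesgue_measure R).
Notation I01 := (`[0%R, 1%R]%classic : set R).
Variables (B : J -> set R) (w : J -> R).

Definition block_family := [/\ forall i, measurable (B i), forall i, B i `<=` I01,
  forall i, mu (B i) = (w i)%:E & trivIset setT B].

Hypothesis Bw : block_family.

Definition block_sum (G : J -> R) (x : R) : R := \sum_i G i * \1_(B i) x.

Lemma block_sum_in i G x : B i x -> block_sum G x = G i.
Proof.
move=> Bix; have [_ _ _ tB] := Bw.
rewrite /block_sum (bigD1 i)//= indicE mem_set// mulr1 big1 ?addr0// => j ji.
rewrite indicE memNset ?mulr0// => Bjx.
by move: ji; rewrite (tB j i)// ?eqxx//; exists x.
Qed.

Lemma block_sum_cases x :
  (exists2 i, B i x & forall G, block_sum G x = G i) \/ (forall G, block_sum G x = 0).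
Proof.
have [[i Bix]|noB] := EM (exists i, B i x); [left|right].
  by exists i => // G; exact: block_sum_in.
move=> G; rewrite /block_sum big1// => i _.
by rewrite indicE memNset ?mulr0// => Bix; apply: noB; exists i.
Qed.

Lemma Rintegral_block_sum G :
  \int[mu]_(x in I01) block_sum G x = \sum_i G i * w i.
Proof.
have [mB BI muB _] := Bw.
rewrite /Rintegral /block_sum; under eq_integral do rewrite -sumEFin.
have int1 i : mu.-integrable I01 (fun x => (\1_(B i) x)%:E).
  apply/integrableP; split; first by apply/measurable_EFinP; exact: (measurable_indic (mB i)).
  under eq_integral do rewrite gee0_abs ?lee_fin//.
  rewrite integral_indic//; last exact: mB.
  by rewrite (setIidl (BI i)) [ltLHS](muB i) ltry.
have int2 i : mu.-integrable I01 (fun x => (G i * \1_(B i) x)%:E).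
  exact: (integrableZl _ (G i) (int1 i)).
rewrite integral_sum//.
rewrite (eq_bigr (fun i => (G i * w i)%:E)) ?sumEFin// => i _.
rewrite EFinM -muB -[in RHS](setIidl (BI i)) -integral_indic//; last exact: mB.
exact: (integralZl _ (int1 i)).
Qed.

(** At a given [x] the block sum is a single term or zero, so it commutes with
    the integral in [y] of arbitrary functions. *)
Lemma Rintegral_under_block_sum (H : J -> R -> R) x :
  \int[mu]_(y in I01) block_sum (H^~ y) x =
  block_sum (fun i => \int[mu]_(y in I01) H i y) x.
Proof.
case: (block_sum_cases x) => [[i _ iE]|E0].
  by rewrite iE; apply: eq_Rintegral => y _; rewrite iE.
rewrite E0 -[RHS](mul0r (fine (mu I01))) -Rintegral_cst//.
by apply: eq_Rintegral => y _; rewrite E0.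
Qed.

Definition block_kernel (M : J -> J -> R) (x y : R) : R :=
  block_sum (fun i => block_sum (M i) y) x.

Lemma Rintegral_block_kernel M :
  \int[mu]_(x in I01) \int[mu]_(y in I01) block_kernel M x y =
  \sum_i \sum_j M i j * w i * w j.
Proof.
under eq_Rintegral do rewrite Rintegral_under_block_sum.
rewrite Rintegral_block_sum; apply: eq_bigr => i _.
rewrite Rintegral_block_sum mulr_suml; apply: eq_bigr => j _; ring.
Qed.

Lemma edge_density_block_kernel M :
  edge_density (block_kernel M) = \sum_i \sum_j M i j * w i * w j.
Proof. exact: Rintegral_block_kernel. Qed.

Lemma triangle_density_block_kernel M : triangle_density (block_kernel M) =
  \sum_i \sum_j \sum_k M i j * M j k * M i k * (w i * w j * w k).
Proof.
pose H i j k := M i j * M j k * M i k.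
have prodE x y z : block_kernel M x y * block_kernel M y z * block_kernel M x z =
    block_sum (fun i => block_sum (fun j => block_sum (H i j) z) y) x.
  rewrite /block_kernel.
  case: (block_sum_cases x) => [[i _ xE]|xE]; rewrite !xE; last by rewrite mulr0.
  case: (block_sum_cases y) => [[j _ yE]|yE]; rewrite !yE; last by rewrite !mul0r.
  by case: (block_sum_cases z) => [[k _ zE]|zE]; rewrite !zE// mulr0.
rewrite /triangle_density.
transitivity (\int[mu]_(x in I01) block_sum (fun i =>
    \sum_j (\sum_k H i j k * w k) * w j) x).
  apply: eq_Rintegral => x _.
  transitivity (\int[mu]_(y in I01) block_sum (fun i =>
      block_sum (fun j => \sum_k H i j k * w k) y) x).
    apply: eq_Rintegral => y _.
    transitivity (\int[mu]_(z in I01)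
        block_sum (fun i => block_sum (fun j => block_sum (H i j) z) y) x).
      by apply: eq_Rintegral => z _; exact: prodE.
    rewrite Rintegral_under_block_sum; apply: eq_bigr => i _; congr (_ * _).
    rewrite Rintegral_under_block_sum; apply: eq_bigr => j _; congr (_ * _).
    exact: Rintegral_block_sum.
  rewrite Rintegral_under_block_sum; apply: eq_bigr => i _; congr (_ * _).
  exact: Rintegral_block_sum.
rewrite Rintegral_block_sum; apply: eq_bigr => i _.
rewrite mulr_suml; apply: eq_bigr => j _; rewrite !mulr_suml.
by apply: eq_bigr => k _; rewrite /H; ring.
Qed.

Lemma graphon_rate_block_kernel p M : I01 `<=` \bigcup_i B i ->
  graphon_rate p (block_kernel M) = \sum_i \sum_j rate p (M i j) * w i * w j.
Proof.
move=> cover; rewrite -Rintegral_block_kernel.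
apply: eq_Rintegral => x /set_mem /cover[i _ Bix].
apply: eq_Rintegral => y /set_mem /cover[j _ Bjy].
by rewrite /block_kernel !(block_sum_in _ Bix) !(block_sum_in _ Bjy).
Qed.

Lemma graphon_block_kernel M : (forall i j, M i j = M j i) ->
  (forall i j, 0 <= M i j <= 1) -> graphon (block_kernel M).
Proof.
move=> symM M01; have [mB _ _ _] := Bw; split.
- apply: measurable_sum => i; apply: measurable_funM.
    apply: measurable_sum => j; apply: measurable_funM => //.
    by apply: measurableT_comp; [exact: measurable_indic|exact: measurable_funTS].
  by apply: measurableT_comp; [exact: measurable_indic|exact: measurable_funTS].
- move=> x y _ _; rewrite /block_kernel.
  case: (block_sum_cases x) => [[i _ xE]|xE]; rewrite !xE.
    by case: (block_sum_cases y) => [[j _ yE]|yE]; rewrite !yE ?xE.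
  by case: (block_sum_cases y) => [[j _ yE]|yE]; rewrite !yE ?xE.
- move=> x y _ _; rewrite /block_kernel.
  case: (block_sum_cases x) => [[i _ xE]|xE]; rewrite !xE; last by rewrite lexx ler01.
  by case: (block_sum_cases y) => [[j _ yE]|yE]; rewrite !yE ?lexx ?ler01.
Qed.

End BlockFunctions.

(** * Two-block graphons and the replica symmetric phase *)

Section TwoBlocks.
Context {R : realType}.
Implicit Types p t q r s m : R.

Lemma graphon_rate_ge0 p (f : R -> R -> R) : 0 < p < 1 -> graphon f ->
  0 <= graphon_rate p f.
Proof.
move=> p01 [_ _ f01]; apply: Rintegral_ge0 => x /mem_set Ix.
by apply: Rintegral_ge0 => y /mem_set Iy; apply: rate_ge0 => //; exact: f01.
Qed.

Lemma inf_rate_le p t (f : R -> R -> R) : 0 < p < 1 -> upper_tail t f ->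
  inf_rate p t <= graphon_rate p f.
Proof.
move=> p01 tf; apply: ge_inf; last by exists f.
by exists 0 => _ [g [gW _] <-]; exact: graphon_rate_ge0.
Qed.

Definition cut_interval m (b : bool) : set R :=
  if b then `[0, m[%classic else `[m, 1]%classic.

Lemma block_family_cut_interval m : 0 < m < 1 ->
  block_family (cut_interval m) (fun b => if b then m else 1 - m).
Proof.
move=> /andP[m0 m1]; split.
- by case; exact: measurable_itv.
- case=> x /=; rewrite !in_itv /= => /andP[x0 x1]; rewrite ?x0 ?x1 ?andbT /=.
    exact/ltW/(lt_trans x1).
  exact/(le_trans _ x0)/ltW.
- case; rewrite /= lebesgue_measure_itv /= lte_fin ?m0 ?m1 -EFinB ?subr0//.
- by case; case=> _ _ [x [/=]]; rewrite /= ?in_itv //= => /andP[a b] /andP[c d];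
    lra.
Qed.

Definition two_block r s (a b : bool) : R := if a == b then s else r.

(** The two parts are the intervals of lengths [m] and [1 - m], where [m] is a
    root of [m * (1 - m) = q]. *)
Lemma rate_le_two_block p t q r s : 0 < p < 1 -> inf_rate p t = rate p t ->
  0 < q <= 4^-1 -> 0 <= r <= 1 -> 0 <= s <= 1 ->
  t ^+ 3 <= s ^+ 3 + 3 * q * s * (r ^+ 2 - s ^+ 2) ->
  rate p t <= rate p s + 2 * q * (rate p r - rate p s).
Proof.
move=> p01 infE /andP[q0 q4] r01 s01 tri.
pose m := (1 - Num.sqrt (1 - 4 * q)) / 2.
have d0 : 0 <= 1 - 4 * q by lra.
have sq := sqr_sqrtr d0.
have sq0 := sqrtr_ge0 (1 - 4 * q).
have qE : q = m * (1 - m) by rewrite /m; nra.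
have m01 : 0 < m < 1.
  have : Num.sqrt (1 - 4 * q) < 1 by rewrite -[ltRHS]sqrtr1 ltr_sqrt//; lra.
  by rewrite /m => ?; apply/andP; split; lra.
have blk := block_family_cut_interval m01.
have symM a b : two_block r s a b = two_block r s b a by rewrite /two_block eq_sym.
have M01 a b : 0 <= two_block r s a b <= 1 by rewrite /two_block; case: ifP.
have cover : (`[0, 1]%classic : set R) `<=` \bigcup_b cut_interval m b.
  move=> x /=; rewrite in_itv /= => /andP[x0 x1].
  have [xm|mx] := ltP x m; first by exists true => //=; rewrite in_itv/= x0.
  by exists false => //=; rewrite in_itv/= mx.
have := @inf_rate_le p t (block_kernel (cut_interval m) (two_block r s)) p01.
rewrite (graphon_rate_block_kernel blk)// infE !big_bool /two_block /=.
rewrite qE => h; apply: le_trans (h _) _; last by nra.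
split; first exact: (graphon_block_kernel blk).
rewrite (triangle_density_block_kernel blk) !big_bool /two_block /=.
apply: le_trans tri _; rewrite qE le_eqVlt; apply/orP; left; apply/eqP; ring.
Qed.

Lemma replica_symmetric_quadratic_minorant p t : 0 < p -> p < t -> t < 1 ->
  inf_rate p t = rate p t ->
  quadratic_minorant p t ((logit t - logit p) / (4 * t)).
Proof.
move=> p0 pt t1 infE; apply: two_block_tangent => // q r s.
by apply: rate_le_two_block => //; rewrite p0 (lt_trans pt).
Qed.

End TwoBlocks.

Section GraphGraphons.
Context {R : realType} {n : nat}.
Implicit Types X : sgraph n.

Definition graph_interval (i : 'I_n) : set R :=
  `[i%:R / n%:R, i.+1%:R / n%:R[%classic.

Lemma graph_graphonE X :
  graph_graphon X = block_kernel graph_interval (adjacency X).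
Proof.
apply/funext => x; apply/funext => y.
rewrite /graph_graphon /block_kernel /block_sum; apply: eq_bigr => i _.
by rewrite mulr_suml; apply: eq_bigr => j _; rewrite mulrAC.
Qed.

Hypothesis n0 : (0 < n)%N.
Let n0R : 0 < n%:R :> R. Proof. by rewrite ltr0n. Qed.

Lemma block_family_graph_interval :
  block_family graph_interval (fun _ => n%:R^-1).
Proof.
split.
- by move=> i; exact: measurable_itv.
- move=> i x; rewrite /graph_interval /= !in_itv /= => /andP[x0 x1]; apply/andP; split.
    by apply: le_trans x0; rewrite divr_ge0.
  by apply/ltW/(lt_le_trans x1); rewrite ler_pdivrMr// mul1r ler_nat ltn_ord.
- move=> i; rewrite /graph_interval lebesgue_measure_itv /= lte_fin.
  rewrite ltr_pM2r ?invr_gt0// ltr_nat ltnSn -EFinB -mulrBl -natr1.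
  by rewrite [_ + 1]addrC addrK mul1r.
- rewrite /graph_interval => i j _ _ [x [/=]]; rewrite !in_itv /= !ler_pdivrMr// !ltr_pdivlMr//.
  move=> /andP[ix xi] /andP[jx xj]; apply/val_inj/eqP; rewrite eqn_leq.
  by apply/andP; split; rewrite -ltnS -(ltr_nat R);
    [exact: le_lt_trans ix xj|exact: le_lt_trans jx xi].
Qed.

Lemma edge_density_graph X :
  edge_density (graph_graphon X) = 2 * edge_count X / n%:R ^+ 2 :> R.
Proof.
rewrite graph_graphonE (edge_density_block_kernel block_family_graph_interval).
rewrite -kernel_sum_adjacency mulr_suml; apply: eq_bigr => i _.
by rewrite mulr_suml; apply: eq_bigr => j _; rewrite -mulrA -invfM expr2.
Qed.

Lemma triangle_density_graph X : triangle_density (graph_graphon X) =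
  kernel_triangle (adjacency X) / n%:R ^+ 3 :> R.
Proof.
rewrite graph_graphonE (triangle_density_block_kernel block_family_graph_interval).
rewrite /kernel_triangle mulr_suml; apply: eq_bigr => i _.
rewrite mulr_suml; apply: eq_bigr => j _; rewrite mulr_suml; apply: eq_bigr => k _.
by rewrite -exprVn; congr (_ * _); ring.
Qed.

Lemma graphon_graph X : graphon (graph_graphon X : R -> R -> R).
Proof.
rewrite graph_graphonE; apply: (graphon_block_kernel block_family_graph_interval).
  exact: adjacency_sym.
exact: adjacency_itv.
Qed.

Lemma upper_tail_graph (t : R) X : upper_tail t (graph_graphon X) <->
  t ^+ 3 <= triangle_density (graph_graphon X).
Proof. by split=> [[]//|tX]; split => //; exact: graphon_graph. Qed.

End GraphGraphons.

(** * Upper bound on the second moment *)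

Section UpperBound.
Context {R : realType}.
Implicit Types (p t c eps delta : R) (n k : nat).

Lemma powR_two_thirds_le (x y : R) : 0 <= x -> 0 <= y -> x ^+ 2 <= y ^+ 3 ->
  x `^ (2 / 3) <= y.
Proof.
move=> x0 y0 xy.
have -> : x `^ (2 / 3) = (x ^+ 2) `^ 3^-1 by rewrite -powR_mulrn// -powRrM.
have -> : y = (y ^+ 3) `^ 3^-1 by rewrite -powR_mulrn// -powRrM mulfV// powRr1.
by rewrite ge0_ler_powR// nnegrE exprn_ge0.
Qed.

(** There are at most [5 ^ n] steps: [4 ^ n] rectangles and the shrinking. *)
Lemma card_refinements_le n k : (0 < n)%N ->
  #|{: k.-tuple (refinement 'I_n)}|%:R <= expR (n%:R * (k%:R * ln 5)) :> R.
Proof.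
move=> n0; rewrite mulrCA 2!expRM_natl lnK ?posrE//.
rewrite card_tuple natrX; apply: lerXn2r; rewrite ?nnegrE ?exprn_ge0//.
rewrite -natrX ler_nat card_option card_prod.
have -> : #|{set 'I_n}| = (2 ^ n)%N by rewrite -cardsT -powersetT card_powerset cardsT card_ord.
rewrite -expnMn; case: n n0 => [//|n _].
rewrite !expnS; apply: leq_trans (_ : _ <= 5 * 4 ^ n)%N _; last first.
  by rewrite leq_mul2l; case: n => [//|n]; rewrite leq_exp2r.
by rewrite -addn1 [(5 * _)%N]mulSn addnC leq_add2r expn_gt0.
Qed.

(** The Gaussian bound on each edge produces [c / 2] times the square of the sum
    of the two entries of [W] at that edge. These add up to at most
    [c * |W|^2], which the term [- |W|^2] of [2 * <A, W> - |W|^2] cancels. *)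
Lemma expectation_exp_kernel_dot n p c (W : 'I_n -> 'I_n -> R) t : 0 < p < 1 ->
  0 < c -> quadratic_minorant p t c ->
  \sum_(X : sgraph n) erdos_renyi p X * expR (c * (2 * kernel_dot (adjacency X) W)) <=
  expR (c * kernel_dot W W + num_edges n * (2 * (c * t ^+ 2 - rate p t))).
Proof.
move=> p01 c0 minor; have /andP[p0 p1] := p01.
have -> : \sum_(X : sgraph n) erdos_renyi p X * expR (c * (2 * kernel_dot (adjacency X) W))
    = \sum_(X : sgraph n) erdos_renyi p X *
      \prod_e expR (2 * c * ((X e)%:R * pair_sum e W)).
  apply: eq_bigr => X _; rewrite -expR_sum -mulr_sumr -kernel_dot_adjacency.
  by congr (_ * expR _); ring.
rewrite (erdos_renyi_prod p (fun e b => expR (2 * c * (b%:R * pair_sum e W)))).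
apply: le_trans (_ : \prod_(e : potential_edge n)
    expR (c / 2 * pair_sum e W ^+ 2 + 2 * (c * t ^+ 2 - rate p t)) <= _).
  apply: ler_prod => e _; rewrite mul0r mulr0 expR0 mulr1 mul1r.
  rewrite addr_ge0 ?mulr_ge0 ?expR_ge0 ?subr_ge0 ?(ltW p0) ?(ltW p1)//= [p * _ + _]addrC.
  have := bernoulli_mgf_quadratic (pair_sum e W / 2) p01 c0 minor.
  have -> : 4 * c * (pair_sum e W / 2) = 2 * c * pair_sum e W by field.
  by have -> : 2 * c * (pair_sum e W / 2) ^+ 2 = c / 2 * pair_sum e W ^+ 2 by field.
rewrite -expR_sum ler_expR big_split /= -mulr_sumr sumr_const -[_ *+ #|_|]mulr_natl lerD2r.
have := sum_pair_sum_sqr_le W.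
set S := \sum_e _ => S_le.
by apply: le_trans (_ : c / 2 * (2 * kernel_dot W W) <= _);
  rewrite ?ler_pM2l ?divr_gt0//; lra.
Qed.

(** The additive error in the triangle count is absorbed into [delta] through
    [x^3 + delta^3 <= (x + delta)^3]. *)
Lemma triangle_power_le_energy n k eps delta (X : sgraph n) : (0 < n)%N ->
  0 <= eps <= 1 -> 1 < k%:R * eps ^+ 2 -> 0 <= delta -> 15 * eps <= delta ^+ 3 ->
  exists s : k.-tuple (refinement 'I_n), let W : 'I_n -> 'I_n -> R := approximant eps s in
    n%:R ^+ 2 * triangle_density (graph_graphon X) `^ (2 / 3) <=
    2 * kernel_dot (adjacency X) W - kernel_dot W W + (2 * eps + delta) * n%:R ^+ 2.
Proof.
move=> n0 eps01 keps d0 eps_d; have n0R : 0 < n%:R :> R by rewrite ltr0n.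
have I0 : (0 < #|'I_n|)%N by rewrite card_ord.
have [s] := kernel_triangle_le_energy eps01 I0 keps (adjacency_itv X).
rewrite /= card_ord => -[W0 WA tri]; exists s => /=.
set W := approximant eps s in W0 WA tri *; set D := kernel_dot W W in W0 WA tri *.
have n2 : 0 < n%:R ^+ 2 :> R by rewrite exprn_gt0.
have D0 : 0 <= D / n%:R ^+ 2 by rewrite divr_ge0// ltW.
have : triangle_density (graph_graphon X) `^ (2 / 3) <= D / n%:R ^+ 2 + delta.
  apply: powR_two_thirds_le; [|exact: addr_ge0|].
    rewrite triangle_density_graph// divr_ge0 ?exprn_ge0//.
    by have /andP[] := kernel_triangle_itv (@adjacency_itv R _ X).
  rewrite triangle_density_graph//.
  apply: le_trans (_ : (D / n%:R ^+ 2) ^+ 3 + delta ^+ 3 <= _); last first.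
    rewrite -subr_ge0.
    have -> : (D / n%:R ^+ 2 + delta) ^+ 3 - ((D / n%:R ^+ 2) ^+ 3 + delta ^+ 3) =
      3 * (D / n%:R ^+ 2) * delta * (D / n%:R ^+ 2 + delta) by ring.
    by rewrite !mulr_ge0// addr_ge0.
  apply: le_trans (_ : (D / n%:R ^+ 2) ^+ 3 + 15 * eps <= _); last by rewrite lerD2l.
  rewrite -(@ler_pM2r _ (n%:R ^+ 6)) ?exprn_gt0//.
  have -> : (kernel_triangle (adjacency X) / n%:R ^+ 3) ^+ 2 * n%:R ^+ 6 =
    kernel_triangle (adjacency X) ^+ 2 :> R by field; rewrite lt0r_neq0.
  have -> // : ((D / n%:R ^+ 2) ^+ 3 + 15 * eps) * n%:R ^+ 6 = D ^+ 3 + 15 * eps * n%:R ^+ 6.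
  by field; rewrite lt0r_neq0.
rewrite -(ler_pM2l n2) mulrDr mulrCA mulfV ?lt0r_neq0// mulr1 => h.
apply: le_trans h _; lra.
Qed.

(** The union bound over sequences of refinements costs a factor exponential in
    [n] only, against the scale [n ^+ 2]. *)
Lemma exponential_moment_le n k p t c eps delta : (0 < n)%N ->
  0 < p < 1 -> 0 < c -> quadratic_minorant p t c ->
  0 <= eps <= 1 -> 1 < k%:R * eps ^+ 2 -> 0 <= delta -> 15 * eps <= delta ^+ 3 ->
  \sum_(X : sgraph n) erdos_renyi p X *
    expR (n%:R ^+ 2 * (c * triangle_density (graph_graphon X) `^ (2 / 3))) <=
  expR (n%:R * (k%:R * ln 5) + n%:R ^+ 2 * (c * (2 * eps + delta))
        + num_edges n * (2 * (c * t ^+ 2 - rate p t))).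
Proof.
move=> n0 p01 c0 minor eps01 keps d0 eps_d.
pose dec (s : k.-tuple (refinement 'I_n)) : 'I_n -> 'I_n -> R := approximant eps s.
pose f s (X : sgraph n) := expR (c * (2 * kernel_dot (adjacency X) (dec s)))
  * expR (c * ((2 * eps + delta) * n%:R ^+ 2 - kernel_dot (dec s) (dec s))).
apply: le_trans (_ : \sum_(X : sgraph n) erdos_renyi p X * \sum_s f s X <= _).
  apply: ler_sum => X _; rewrite ler_wpM2l ?(ltW (erdos_renyi_gt0 _ _))//.
  have [s /= le_s] := triangle_power_le_energy X n0 eps01 keps d0 eps_d.
  rewrite (bigD1 s)//= -[leLHS]addr0 lerD//; last first.
    by apply: sumr_ge0 => ? _; rewrite mulr_ge0 ?expR_ge0.
  rewrite /f -expRD ler_expR -mulrDr mulrCA ler_pM2l//.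
  by apply: le_trans le_s _; rewrite /dec; lra.
have -> : \sum_(X : sgraph n) erdos_renyi p X * (\sum_s f s X) =
    \sum_s \sum_(X : sgraph n) erdos_renyi p X * f s X.
  by rewrite exchange_big; apply: eq_bigr => X _; rewrite mulr_sumr.
apply: le_trans (_ : \sum_(s : k.-tuple (refinement 'I_n)) expR (n%:R ^+ 2 * (c * (2 * eps + delta))
        + num_edges n * (2 * (c * t ^+ 2 - rate p t))) <= _).
  apply: ler_sum => s _; rewrite /f.
  under eq_bigr do rewrite mulrA.
  rewrite -mulr_suml.
  apply: le_trans (ler_wpM2r (expR_ge0 _) (expectation_exp_kernel_dot (dec s) p01 c0 minor)) _.
  by rewrite -expRD ler_expR; nra.
rewrite sumr_const -[_ *+ #|_|]mulr_natl -addrA [leRHS]expRD ler_wpM2r ?expR_ge0//.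
exact: card_refinements_le.
Qed.

Definition exponential_moment n p (beta alpha : R) : R :=
  \sum_(X : sgraph n) erdos_renyi p X *
    expR (n%:R ^+ 2 * (beta / 6 * triangle_density (graph_graphon X) `^ alpha)).

Lemma exponential_moment_gt0 n p (beta alpha : R) : 0 < p < 1 ->
  0 < exponential_moment n p beta alpha.
Proof.
move=> p01; rewrite /exponential_moment (bigD1 [ffun=> true])//= ltr_pwDl//.
  by rewrite mulr_gt0 ?expR_gt0 ?erdos_renyi_gt0.
by apply: sumr_ge0 => X _; rewrite mulr_ge0 ?expR_ge0 ?(ltW (erdos_renyi_gt0 _ _)).
Qed.

(** The tilt with edge parameter [logit p] is a reweighting of the Erdos-Renyi
    law by the triangle factor alone. *)
Lemma triangle_tiltE n p (beta alpha : R) (X : sgraph n) : (0 < n)%N -> 0 < p < 1 ->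
  triangle_tilt (logit p) beta alpha X = erdos_renyi p X *
    expR (n%:R ^+ 2 * (beta / 6 * triangle_density (graph_graphon X) `^ alpha))
    / exponential_moment n p beta alpha.
Proof.
move=> n0 p01.
have tiltE (Y : sgraph n) : tilt_weight (logit p) beta alpha Y =
    expR (- (num_edges n * ln (1 - p))) * (erdos_renyi p Y *
    expR (n%:R ^+ 2 * (beta / 6 * triangle_density (graph_graphon Y) `^ alpha))).
  rewrite erdos_renyi_exp// -!expRD /tilt_weight edge_density_graph//.
  by congr expR; field; rewrite lt0r_neq0// ltr0n.
rewrite /triangle_tilt tiltE; under eq_bigr do rewrite tiltE.
rewrite -mulr_sumr -/(exponential_moment n p beta alpha) invfM mulrACA mulfV ?mul1r//.
by rewrite lt0r_neq0// expR_gt0.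
Qed.

(** On the event, the triangle factor is at least its value at [t ^+ 3]. This is
    used twice: to bound the likelihood ratio and, as in Markov's inequality,
    to bound the indicator of the event. *)
Lemma second_moment_le n p t (beta alpha : R) : (0 < n)%N -> 0 < p < 1 ->
  0 <= t -> 0 <= beta -> 0 <= alpha ->
  second_moment p t (@triangle_tilt R n (logit p) beta alpha) <=
  (exponential_moment n p beta alpha
     * expR (- (n%:R ^+ 2 * (beta / 6 * (t ^+ 3) `^ alpha)))) ^+ 2.
Proof.
move=> n0 p01 t0 beta0 alpha0; set Z := exponential_moment n p beta alpha.
have Z0 : 0 < Z := exponential_moment_gt0 n beta alpha p01.
set a := expR (- _).
have -> : (Z * a) ^+ 2 = \sum_(X : sgraph n) erdos_renyi p X *
    expR (n%:R ^+ 2 * (beta / 6 * triangle_density (graph_graphon X) `^ alpha)) * (Z * a ^+ 2).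
  by rewrite -mulr_suml -/(exponential_moment n p beta alpha) -/Z; ring.
rewrite /second_moment /expectation_pmf; apply: ler_sum => X _.
rewrite triangle_tiltE// -/Z.
set P := erdos_renyi p X; have P0 : 0 < P := erdos_renyi_gt0 X p01.
set x := n%:R ^+ 2 * (beta / 6 * triangle_density _ `^ _).
have e0 := expR_gt0 x; have a0 : 0 <= a := expR_ge0 _.
rewrite indicE; case: (boolP (_ \in _)) => [/set_mem/upper_tail_graph tX|_]; last first.
  by rewrite mul0r expr0n mulr0 !mulr_ge0// ?exprn_ge0 ?ltW.
have ex : 1 <= expR x * a.
  rewrite -expRD -[leLHS]expR0 ler_expR subr_ge0 ler_wpM2l ?exprn_ge0//.
  rewrite ler_wpM2l ?divr_ge0// ge0_ler_powR ?nnegrE ?exprn_ge0//; last exact: tX.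
  by apply: le_trans (tX n0); rewrite exprn_ge0.
have -> : P * expR x / Z * (true%:R * (P / (P * expR x / Z))) ^+ 2 = P * Z / expR x.
  by rewrite mul1r; field; rewrite !lt0r_neq0.
have -> : P * expR x * (Z * a ^+ 2) = P * Z / expR x * (expR x * a) ^+ 2.
  by field; rewrite lt0r_neq0.
by rewrite ler_peMr ?exprn_ege1 ?divr_ge0 ?mulr_ge0 ?(ltW P0) ?(ltW Z0) ?(ltW e0).
Qed.

Definition tail_probability n p t : R :=
  \sum_(X : sgraph n) erdos_renyi p X * \1_(upper_tail t) (graph_graphon X : R -> R -> R).

(** Cauchy-Schwarz for the mean of the unbiased estimator. With [a] the tail
    probability and [P] the Erdos-Renyi mass, it is summed up from
    [P^2 / Q >= 2 * a * P - a^2 * Q]. *)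
Lemma sqr_tail_probability_le n p t (Q : sgraph n -> R) : (forall X, 0 < Q X) ->
  \sum_X Q X = 1 -> tail_probability n p t ^+ 2 <= second_moment p t Q.
Proof.
move=> Q0 Q1; set a := tail_probability n p t.
have -> : a ^+ 2 = \sum_X (2 * a * (erdos_renyi p X *
    \1_(upper_tail t) (graph_graphon X : R -> R -> R)) - a ^+ 2 * Q X).
  by rewrite sumrB -!mulr_sumr -/(tail_probability n p t) -/a Q1; ring.
apply: ler_sum => X _; have Q0X := Q0 X; set P := erdos_renyi p X.
set b : R := \1__ _; rewrite -subr_ge0.
have -> : Q X * (b * (P / Q X)) ^+ 2 - (2 * a * (P * b) - a ^+ 2 * Q X) =
    (b * P - a * Q X) ^+ 2 / Q X.
  by field; rewrite lt0r_neq0.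
by rewrite divr_ge0 ?sqr_ge0// ltW.
Qed.

End UpperBound.

(** * Lower bound on the tail probability *)

Section LowerBound.
Context {R : realType} {n : nat}.
Implicit Types (p s t u : R) (X : sgraph n).

Lemma adjacency_edge (i j : 'I_n) : i != j ->
  exists e : potential_edge n, forall X, adjacency X i j = (X e)%:R :> R.
Proof.
move=> ij; have ij2 : #|[set i; j]%SET| == 2%N by rewrite cards2 ij.
exists (exist _ [set i; j]%SET ij2) => X.
rewrite adjacencyE (bigD1 (exist _ [set i; j]%SET ij2))//= eqxx mulr1 big1 ?addr0// => f.
rewrite -val_eqE /= => /negPf fij.
by rewrite fij mulr0.
Qed.

(** Coincidences among the three edges only increase the expectation, to a
    smaller power of [s]. *)
Lemma expectation_three_edges_ge s (e1 e2 e3 : potential_edge n) : 0 <= s <= 1 ->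
  s ^+ 3 <= \sum_(X : sgraph n) erdos_renyi s X * ((X e1)%:R * (X e2)%:R * (X e3)%:R).
Proof.
move=> /andP[s0 s1]; pose S := [:: e1; e2; e3].
pose g e (b : bool) : R := if e \in S then b%:R else 1.
apply: le_trans (_ : \sum_(X : sgraph n) erdos_renyi s X * \prod_e g e (X e) <= _).
  rewrite erdos_renyi_prod.
  rewrite (_ : \prod_e _ = \prod_(e in S) s); last first.
    rewrite [RHS]big_mkcond /=; apply: eq_bigr => e _; rewrite /g; case: ifP => _ /=; ring.
  by rewrite prodr_const ler_wiXn2l ?s0//; exact: (card_size S).
apply: ler_sum => X _; rewrite ler_wpM2l//.
  by apply: prodr_ge0 => e _; case: (X e); rewrite ?subr_ge0.
have g0 e : e \in S -> ~~ X e -> \prod_e g e (X e) = 0.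
  by move=> eS /negPf Xe; rewrite (bigD1 e)//= /g eS Xe mul0r.
case: (boolP (X e1)) => X1; last by rewrite (g0 e1) ?inE ?eqxx// !mul0r.
case: (boolP (X e2)) => X2; last by rewrite (g0 e2) ?inE ?eqxx ?orbT// mulr0 mul0r.
case: (boolP (X e3)) => X3; last by rewrite (g0 e3) ?inE ?eqxx ?orbT// mulr0.
rewrite !mulr1; apply: prodr_ile1 => e _; rewrite /g.
by case: ifP => _; case: (X e); rewrite lexx ?ler01.
Qed.

Lemma erdos_renyi_ge0 s X : 0 <= s <= 1 -> 0 <= erdos_renyi s X.
Proof.
by move=> /andP[s0 s1]; apply: prodr_ge0 => e _; case: (X e); rewrite ?subr_ge0.
Qed.

(** The summand is at most the indicator that [i], [j] and [k] are distinct. *)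
Lemma sum_distinct_triples : \sum_(i : 'I_n) \sum_(j : 'I_n) \sum_(k : 'I_n)
  (1 - (i == j)%:R - (j == k)%:R - (i == k)%:R) = n%:R ^+ 3 - 3 * n%:R ^+ 2 :> R.
Proof.
have sum1 (j : 'I_n) : \sum_(k : 'I_n) (j == k)%:R = 1 :> R.
  by rewrite (bigD1 j)//= eqxx big1 ?addr0// => k; rewrite eq_sym => /negPf->.
transitivity (\sum_(i : 'I_n) \sum_(j : 'I_n) (n%:R - n%:R * (i == j)%:R - 2 : R)).
  apply: eq_bigr => i _; apply: eq_bigr => j _.
  rewrite !sumrB !sum1 !sumr_const card_ord -mulr_natl; ring.
transitivity (\sum_(i : 'I_n) (n%:R * n%:R - n%:R - n%:R * 2 : R)).
  apply: eq_bigr => i _; rewrite !sumrB -mulr_sumr sum1 !sumr_const card_ord.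
  by rewrite -[n%:R *+ n]mulr_natl -[2 *+ n]mulr_natl mulr1.
by rewrite sumr_const card_ord -mulr_natl; ring.
Qed.

Lemma expectation_triangle_ge s : 0 <= s <= 1 ->
  s ^+ 3 * (n%:R ^+ 3 - 3 * n%:R ^+ 2) <=
  \sum_(X : sgraph n) erdos_renyi s X * kernel_triangle (adjacency X).
Proof.
move=> s01; have /andP[s0 s1] := s01; rewrite -sum_distinct_triples mulr_sumr.
have -> : \sum_(X : sgraph n) erdos_renyi s X * kernel_triangle (adjacency X) =
    \sum_i \sum_j \sum_k \sum_(X : sgraph n) erdos_renyi s X *
      (adjacency X i j * adjacency X j k * adjacency X i k).
  under eq_bigr do rewrite mulr_sumr.
  rewrite exchange_big; apply: eq_bigr => i _; under eq_bigr do rewrite mulr_sumr.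
  rewrite exchange_big; apply: eq_bigr => j _; under eq_bigr do rewrite mulr_sumr.
  by rewrite exchange_big.
apply: ler_sum => i _; rewrite mulr_sumr; apply: ler_sum => j _.
rewrite mulr_sumr; apply: ler_sum => k _.
have E0 : 0 <= \sum_(X : sgraph n) erdos_renyi s X *
    (adjacency X i j * adjacency X j k * adjacency X i k).
  apply: sumr_ge0 => X _; rewrite mulr_ge0 ?erdos_renyi_ge0//.
  by rewrite !mulr_ge0// /adjacency ler0n.
have s3 : 0 <= s ^+ 3 by rewrite exprn_ge0.
have [ij|ij] := eqVneq i j.
  by apply: le_trans E0; rewrite mulr_ge0_le0//; case: eqP; case: eqP => _ _ /=; lra.
have [jk|jk] := eqVneq j k.
  by apply: le_trans E0; rewrite mulr_ge0_le0//; case: eqP => _ /=; lra.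
have [ik|ik] := eqVneq i k.
  by apply: le_trans E0; rewrite mulr_ge0_le0//=; lra.
rewrite !subr0 mulr1.
have [e1 E1] := adjacency_edge ij; have [e2 E2] := adjacency_edge jk.
have [e3 E3] := adjacency_edge ik.
by under eq_bigr do rewrite E1 E2 E3; exact: expectation_three_edges_ge.
Qed.

(** The triangle density is at most [1] on the event, and below [t ^+ 3] off
    it. *)
Lemma tail_probability_ge_mean s t : (0 < n)%N -> 0 <= s <= 1 -> 0 <= t ->
  s ^+ 3 * (1 - 3 / n%:R) - t ^+ 3 <= tail_probability n s t.
Proof.
move=> n0 s01 t0; have n0R : 0 < n%:R :> R by rewrite ltr0n.
have n3 : 0 < n%:R ^+ 3 :> R by rewrite exprn_gt0.
rewrite lerBlDr -(ler_pM2r n3).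
have -> : s ^+ 3 * (1 - 3 / n%:R) * n%:R ^+ 3 = s ^+ 3 * (n%:R ^+ 3 - 3 * n%:R ^+ 2).
  by field; rewrite lt0r_neq0.
apply: le_trans (expectation_triangle_ge s01) _.
have -> : tail_probability n s t + t ^+ 3 = \sum_(X : sgraph n) erdos_renyi s X *
    (\1_(upper_tail t) (graph_graphon X : R -> R -> R) + t ^+ 3).
  under [RHS]eq_bigr do rewrite mulrDr.
  by rewrite big_split /= -mulr_suml sum_erdos_renyi mul1r.
rewrite mulr_suml; apply: ler_sum => X _; rewrite -mulrA ler_wpM2l ?erdos_renyi_ge0//.
have /andP[_ T1] := kernel_triangle_itv (@adjacency_itv R n X); rewrite card_ord in T1.
have t3 : 0 <= t ^+ 3 by rewrite exprn_ge0.
rewrite indicE; case: (boolP (_ \in _)) => [_|/negP tX].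
  by apply: le_trans T1 _; rewrite ler_peMl ?(ltW n3)// lerDl.
rewrite add0r -ler_pdivrMr// -triangle_density_graph// leNgt; apply/negP => tX'.
by apply/tX/mem_set/upper_tail_graph => //; exact: ltW.
Qed.

(** Chernoff's bound, with the exponent for which the tilted mean is [u]. *)
Lemma edge_count_upper_tail s u : 0 < s -> s < u -> u < 1 ->
  \sum_(X : sgraph n) erdos_renyi s X * (u * num_edges n < edge_count X)%R%:R <=
  expR (- (2 * num_edges n * rate s u)).
Proof.
move=> s0 su u1; pose th := logit u - logit s.
have th0 : 0 < th by rewrite subr_gt0 ltr_logit.
have s01 : 0 < s < 1 by rewrite s0 (lt_trans su).
have u01 : 0 < u < 1 by rewrite (lt_trans s0).
apply: le_trans (_ : \sum_(X : sgraph n) erdos_renyi s X *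
    (expR (- (th * u * num_edges n)) * \prod_e expR (th * (X e)%:R)) <= _).
  apply: ler_sum => X _; rewrite ler_wpM2l ?(ltW (erdos_renyi_gt0 _ _))//.
  rewrite -expR_sum -mulr_sumr -/(edge_count X) -expRD.
  case: ltP => [ltu|_]; last exact: expR_ge0.
  rewrite -[leLHS]expR0 ler_expR addrC subr_ge0 -mulrA ler_pM2l//; exact: ltW.
under eq_bigr do rewrite mulrCA.
rewrite -mulr_sumr (erdos_renyi_prod s (fun _ b => expR (th * b%:R))).
under eq_bigr do rewrite mulr1 mulr0 expR0 mulr1 addrC (bernoulli_mgf_tilt s01 u01) -/th.
rewrite prodr_const -expRM_natl -expRD ler_expR -/(num_edges n).
rewrite le_eqVlt; apply/orP; left; apply/eqP; ring.
Qed.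

(** Change of measure from [p] to [s] on the graphs of the event with at most
    [u * num_edges n] edges: the likelihood ratio is a decreasing function of
    the number of edges, and [u] bounds it from below. *)
Lemma tail_probability_ge p s t u : (0 < n)%N -> 0 < p -> p <= s -> 0 <= t ->
  s < u -> u < 1 ->
  expR (- (num_edges n * (2 * rate p s + (logit s - logit p) * (u - s)))) *
    (s ^+ 3 * (1 - 3 / n%:R) - t ^+ 3 - expR (- (2 * num_edges n * rate s u)))
  <= tail_probability n p t.
Proof.
move=> n0 p0 ps t0 su u1.
have s0 := lt_le_trans p0 ps; have s1 := lt_trans su u1.
have s01 : 0 < s < 1 by rewrite s0.
have p01 : 0 < p < 1 by rewrite p0 (le_lt_trans ps).
have lps : 0 <= logit s - logit p.
  move: ps; rewrite le_eqVlt subr_ge0 => /predU1P[-> //|ps].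
  by rewrite ltW// ltr_logit.
set a := expR _.
pose w X : R := \1_(upper_tail t) (graph_graphon X : R -> R -> R).
apply: le_trans (_ : a * \sum_(X : sgraph n) erdos_renyi s X *
    (w X - (u * num_edges n < edge_count X)%R%:R) <= _).
  rewrite ler_wpM2l ?expR_ge0//.
  under eq_bigr do rewrite mulrBr.
  rewrite sumrB lerB ?edge_count_upper_tail//.
  by apply: tail_probability_ge_mean => //; rewrite !ltW.
rewrite mulr_sumr; apply: ler_sum => X _; rewrite -/(w X).
have w0 : 0 <= w X by rewrite /w indicE.
have [Ps Pp] := (erdos_renyi_gt0 X s01, erdos_renyi_gt0 X p01).
case: ltP => [_|eu] /=.
  apply: le_trans (_ : 0 <= _); last by rewrite mulr_ge0// ltW.
  rewrite mulr_ge0_le0 ?expR_ge0// mulr_ge0_le0 ?(ltW Ps)// subr_le0.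
  by rewrite /w indicE lern1 leq_b1.
rewrite subr0 mulrA ler_wpM2r// !erdos_renyi_exp// -expRD ler_expR.
rewrite rateE// !logitE// in lps *.
nra.
Qed.

End LowerBound.

(** * Asymptotics *)

Section Asymptotics.
Context {R : realType}.
Implicit Types p t : R.

(** With [delta = min 1 (x / 2)] and [eps = delta ^+ 3 / 15], one has
    [2 * eps <= delta]. *)
Lemma exists_approximation_parameters (x : R) : 0 < x ->
  exists eps delta k, [/\ 0 <= eps <= 1, 1 < k%:R * eps ^+ 2, 0 <= delta,
    15 * eps <= delta ^+ 3 & 2 * eps + delta <= x].
Proof.
move=> x0; pose d := Num.min 1 (x / 2).
have d0 : 0 < d by rewrite lt_min ltr01 divr_gt0.
have d1 : d <= 1 by rewrite ge_min lexx.
have dx : d <= x / 2 by rewrite ge_min lexx orbT.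
have d3 : d ^+ 3 <= d by rewrite exprS ler_piMr ?(ltW d0)// expr_le1// ltW.
have d30 : 0 < d ^+ 3 by rewrite exprn_gt0.
pose eps := d ^+ 3 / 15.
have e0 : 0 < eps by rewrite divr_gt0.
exists eps, d, (Num.truncn (eps ^- 2)).+1; split.
- by rewrite ltW//= /eps; lra.
- by rewrite -ltr_pdivrMr ?exprn_gt0// div1r truncnS_gt.
- exact: ltW.
- by rewrite /eps; lra.
- by rewrite /eps; lra.
Qed.

(** The cost of the change of measure to [s], with at most the fraction [2 * s - t]
    of the edges present, is continuous in [s] and tends to [2 * rate p t] as
    [s] decreases to [t]. For [s] fixed, the errors vanish as [n] grows. *)
Lemma ln_tail_probability_ge p t (x : R) : 0 < p -> p < t -> t < 1 -> 0 < x ->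
  \forall n \near \oo, 0 < tail_probability n p t /\
    - rate p t - x <= (n%:R ^+ 2)^-1 * ln (tail_probability n p t).
Proof.
move=> p0 pt t1 x0; have t0 := lt_trans p0 pt.
have p01 : 0 < p < 1 by rewrite p0 (lt_trans pt).
have t01 : 0 < t < 1 by rewrite t0.
pose kappa s := 2 * rate p s + (logit s - logit p) * (s - t).
have kappa_cvg : kappa s @[s --> t^'+] --> 2 * rate p t.
  have -> : 2 * rate p t = 2 * rate p t + (logit t - logit p) * (t - t) by ring.
  apply: cvg_at_right_filter; apply: cvgD; apply: cvgM; try exact: cvg_cst.
  - exact: continuous_rate.
  - by apply: cvgB; [exact: continuous_logit|exact: cvg_cst].
  - by apply: cvgB; [exact: cvg_id|exact: cvg_cst].
have [s [ts us1 kappa_le]] : exists s, [/\ t < s, 2 * s - t < 1 &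
    kappa s <= 2 * rate p t + x].
  have : \forall s \near t^'+, [/\ t < s, 2 * s - t < 1 & kappa s <= 2 * rate p t + x].
    near=> s; split.
    - by near: s; exact: nbhs_right_gt.
    - have : s < (1 + t) / 2 by near: s; apply: nbhs_right_lt; lra.
      lra.
    - by near: s; apply: (cvgr_le _ kappa_cvg); rewrite ltrDl.
  by move/filter_ex.
pose u := 2 * s - t.
have su : s < u by rewrite /u; lra.
have s0 := lt_trans t0 ts; have s1 := lt_trans su us1.
have s01 : 0 < s < 1 by rewrite s0.
have u01 : 0 < u < 1 by rewrite (lt_trans s0).
pose d := s ^+ 3 - t ^+ 3.
have d0 : 0 < d by rewrite subr_gt0 ltrXn2r ?(ltW t0).
have rho0 : 0 < rate s u by rewrite rate_gt0// gt_eqF.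
have kappa0 : 0 <= kappa s.
  have rate0 : 0 <= rate p s by apply: rate_ge0; rewrite ?(ltW s0) ?(ltW s1).
  have logit0 : 0 <= logit s - logit p by rewrite subr_ge0 ltW// ltr_logit// (lt_trans pt).
  by rewrite /kappa addr_ge0// mulr_ge0// subr_ge0 ltW.
near=> n.
have n1 : (1 < n)%N by near: n; exact: nbhs_infty_gt.
have n0 : (0 < n)%N by exact: ltnW.
have n0R : 0 < n%:R :> R by rewrite ltr0n.
have n2R : 2 <= n%:R :> R by rewrite ler_nat.
have tri_err : s ^+ 3 * (3 / n%:R) <= d / 4.
  rewrite mulrA ler_pdivrMr// -ler_pdivrMl ?divr_gt0//.
  by near: n; exact: nbhs_infty_ger.
have N_ge : n%:R <= 2 * num_edges n :> R.
  by rewrite num_edgesE; nra.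
have N_le : 2 * num_edges n <= n%:R ^+ 2 :> R by rewrite num_edgesE; nra.
have chernoff_err : expR (- (2 * num_edges n * rate s u)) <= d / 4.
  rewrite expRN; have y0 : 0 < n%:R * rate s u by rewrite mulr_gt0.
  apply: le_trans (_ : (n%:R * rate s u)^-1 <= _).
    rewrite lef_pV2 ?posrE ?expR_gt0//.
    apply: le_trans (_ : 2 * num_edges n * rate s u <= _); first by rewrite ler_pM2r.
    by apply: le_trans (expR_ge1Dx _); rewrite lerDr.
  rewrite -[d / 4]invrK lef_pV2 ?posrE ?invr_gt0 ?divr_gt0// -ler_pdivrMr//.
  by near: n; exact: nbhs_infty_ger.
have tail_ge : expR (- (num_edges n * kappa s)) * (d / 2) <= tail_probability n p t.
  have := tail_probability_ge n0 p0 (ltW (lt_trans pt ts)) (ltW t0) su us1.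
  apply: le_trans; have -> : u - s = s - t by rewrite /u; ring.
  by rewrite ler_wpM2l ?expR_ge0// mulrBr mulr1; rewrite /d in tri_err chernoff_err *; lra.
have d2 : 0 < d / 2 by rewrite divr_gt0.
have tail0 : 0 < tail_probability n p t.
  by apply: lt_le_trans tail_ge; rewrite mulr_gt0 ?expR_gt0.
split => //; have n2 : 0 < n%:R ^+ 2 :> R by rewrite exprn_gt0.
rewrite mulrC ler_pdivlMr//.
apply: le_trans (_ : ln (expR (- (num_edges n * kappa s)) * (d / 2)) <= _); last first.
  by rewrite ler_ln ?posrE// mulr_gt0 ?expR_gt0.
rewrite lnM ?posrE ?expR_gt0// expRK.
have ln_err : - (x / 2 * n%:R) <= ln (d / 2).
  rewrite lerNl -ler_pdivrMl ?divr_gt0//.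
  by near: n; exact: nbhs_infty_ger.
have : 2 * num_edges n * kappa s <= n%:R ^+ 2 * (2 * rate p t + x).
  by rewrite ler_pM// mulr_ge0// num_edgesE; nra.
have : x * n%:R <= x * n%:R ^+ 2 by rewrite ler_pM2l// ler_eXnr// ler1n.
nra.
Unshelve. all: by end_near.
Qed.

Lemma ln_exponential_moment_le p t c (x : R) : 0 < p < 1 -> 0 < c -> 0 < x ->
  quadratic_minorant p t c ->
  \forall n \near \oo,
    (n%:R ^+ 2)^-1 * ln (exponential_moment n p (6 * c) (2 / 3)) <=
    c * t ^+ 2 - rate p t + x.
Proof.
move=> p01 c0 x0 minor.
have x2c : 0 < x / (2 * c) by rewrite divr_gt0// mulr_gt0.
have [eps [delta [k [eps01 keps delta0 eps_delta small]]]] := exists_approximation_parameters x2c.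
have {}small : c * (2 * eps + delta) <= x / 2.
  rewrite -ler_pdivlMl//; apply: le_trans small _.
  by rewrite le_eqVlt; apply/orP; left; apply/eqP; field; rewrite lt0r_neq0.
pose C := k%:R * ln 5 - (c * t ^+ 2 - rate p t).
near=> n.
have n0 : (0 < n)%N by near: n; exact: nbhs_infty_gt.
have n0R : 0 < n%:R :> R by rewrite ltr0n.
have n2 : 0 < n%:R ^+ 2 :> R by rewrite exprn_gt0.
have C_le : C <= x / 2 * n%:R.
  by rewrite -ler_pdivrMl ?divr_gt0//; near: n; exact: nbhs_infty_ger.
have := exponential_moment_le n0 p01 c0 minor eps01 keps delta0 eps_delta.
have cE : c = 6 * c / 6 by field.
rewrite {1}cE -/(exponential_moment n p (6 * c) (2 / 3)) => Z_le.
have Z0 := exponential_moment_gt0 n (6 * c) (2 / 3) p01.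
rewrite mulrC ler_pdivrMr//.
apply: le_trans (_ : ln (expR _) <= _).
  by rewrite ler_ln ?posrE; [exact: Z_le|exact: Z0|exact: expR_gt0].
rewrite expRK num_edgesE.
have : n%:R * C <= n%:R * (x / 2 * n%:R) by rewrite ler_pM2l.
have : n%:R ^+ 2 * (c * (2 * eps + delta)) <= n%:R ^+ 2 * (x / 2) by rewrite ler_pM2l.
rewrite /C; nra.
Unshelve. all: by end_near.
Qed.

Lemma sum_triangle_tilt n p (beta alpha : R) : (0 < n)%N -> 0 < p < 1 ->
  \sum_(X : sgraph n) triangle_tilt (logit p) beta alpha X = 1.
Proof.
move=> n0 p01; under eq_bigr do rewrite triangle_tiltE//.
by rewrite -mulr_suml mulfV// lt0r_neq0// exponential_moment_gt0.
Qed.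

Lemma triangle_tilt_gt0 n p (beta alpha : R) (X : sgraph n) : (0 < n)%N -> 0 < p < 1 ->
  0 < triangle_tilt (logit p) beta alpha X.
Proof.
move=> n0 p01; rewrite triangle_tiltE// divr_gt0 ?exponential_moment_gt0//.
by rewrite mulr_gt0 ?expR_gt0 ?erdos_renyi_gt0.
Qed.

Lemma optimal_of_quadratic_minorant p t c : 0 < p -> p < t -> t < 1 -> 0 < c ->
  inf_rate p t = rate p t -> quadratic_minorant p t c ->
  asymptotically_optimal p t
    (fun n => @triangle_tilt R n (logit p) (6 * c) (2 / 3)).
Proof.
move=> p0 pt t1 c0 infE minor; have t0 := lt_trans p0 pt.
have p01 : 0 < p < 1 by rewrite p0 (lt_trans pt).
rewrite /asymptotically_optimal infE; apply/cvgrPdist_le => x x0.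
have x2 : 0 < x / 2 by rewrite divr_gt0.
near=> n.
have n0 : (0 < n)%N by near: n; exact: nbhs_infty_gt.
have n2 : 0 < (n%:R ^+ 2)^-1 :> R by rewrite invr_gt0 exprn_gt0// ltr0n.
have [tail0 lower] : 0 < tail_probability n p t /\
    - rate p t - x / 2 <= (n%:R ^+ 2)^-1 * ln (tail_probability n p t).
  by near: n; exact: ln_tail_probability_ge.
have upper : (n%:R ^+ 2)^-1 * ln (exponential_moment n p (6 * c) (2 / 3)) <=
    c * t ^+ 2 - rate p t + x / 2.
  by near: n; exact: ln_exponential_moment_le.
set Q := triangle_tilt _ _ _.
have SM_ge : tail_probability n p t ^+ 2 <= second_moment p t Q.
  apply: sqr_tail_probability_le => [X|]; first exact: triangle_tilt_gt0.
  exact: sum_triangle_tilt.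
have SM0 : 0 < second_moment p t Q by apply: lt_le_trans SM_ge; rewrite exprn_gt0.
have Z0 := exponential_moment_gt0 n (6 * c) (2 / 3) p01.
have SM_le : second_moment p t Q <= (exponential_moment n p (6 * c) (2 / 3)
     * expR (- (n%:R ^+ 2 * (c * t ^+ 2)))) ^+ 2.
  have -> : c * t ^+ 2 = 6 * c / 6 * (t ^+ 3) `^ (2 / 3).
    have -> : (t ^+ 3) `^ (2 / 3) = t ^+ 2.
      rewrite -(@powR_mulrn _ t 3 (ltW t0)) -powRrM mulrCA mulfV// mulr1.
      exact/powR_mulrn/ltW.
    by field.
  by apply: second_moment_le; rewrite ?(ltW t0) ?mulr_ge0 ?(ltW c0).
rewrite ler_distl; apply/andP; split.
  have : ln (second_moment p t Q) <=
      2 * (ln (exponential_moment n p (6 * c) (2 / 3)) - n%:R ^+ 2 * (c * t ^+ 2)).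
    apply: le_trans (_ : ln (_ ^+ 2) <= _).
      by rewrite ler_ln ?posrE; [exact: SM_le| | ]; rewrite ?exprn_gt0 ?mulr_gt0 ?expR_gt0.
    by rewrite lnXn ?mulr_gt0 ?expR_gt0// lnM ?posrE ?expR_gt0// expRK [leRHS]mulr_natl.
  rewrite -(ler_pM2l n2) mulrCA mulrBr [X in _ - X]mulrA mulVf ?mul1r;
    last by rewrite -invr_eq0 lt0r_neq0.
  lra.
have : 2 * ln (tail_probability n p t) <= ln (second_moment p t Q).
  by rewrite mulr_natl -lnXn// ler_ln ?posrE// exprn_gt0.
rewrite -(ler_pM2l n2) mulrCA; lra.
Unshelve. all: by end_near.
Qed.

End Asymptotics.

(** * The optimal tilt *)

Theorem proposition4p1 (R : realType) (p t : R) (p_gt0 : 0 < p) (p_lt_t : p < t)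
    (t_lt1 : t < 1) (rs : replica_symmetric p t) :
  exists alpha : R, 2 / 3 <= alpha <= 1 /\
    asymptotically_optimal p t (fun n : nat =>
      @triangle_tilt R n (logit p)
        ((logit t - logit p) / (alpha * t `^ (3 * alpha - 1))) alpha).
Proof.
have t_gt0 := lt_trans p_gt0 p_lt_t; have [infE _] := rs.
exists (2 / 3); split; first by lra.
have -> : (logit t - logit p) / (2 / 3 * t `^ (3 * (2 / 3) - 1)) =
    6 * ((logit t - logit p) / (4 * t)).
  have -> : 3 * (2 / 3) - 1 = 1 :> R by field.
  by rewrite powRr1 ?(ltW t_gt0)//; field; rewrite lt0r_neq0.
apply: optimal_of_quadratic_minorant => //.
  by rewrite divr_gt0 ?mulr_gt0// subr_gt0 ltr_logit.
exact: replica_symmetric_quadratic_minorant.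
Qed.
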